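(* Let $K$ be a field of positive characteristic, let $n\in\mathbb{N}$, and let $G\leq GL_n(K)$ be a finitely generated subgroup. There exists a proper, left-invariant metric on $G$ such that the metric family $\{F\backslash G\}_{F\in\mathcal{F}in}$, where $\mathcal{F}in$ is the set of all finite subgroups of $G$, has finite asymptotic dimension uniformly.
   Context: A metric $d$ on a group $G$ is left-invariant if $d(gh,gh')=d(h,h')$ for all $g,h,h'\in G$, and proper if all balls of finite radius are finite. For a finite subgroup $F\leq G$ the quotient $F\backslash G$ carries the quotient metric $d(Fg,Fh)=\min_{f\in F}d(g,fh)$. A metric family is a set of metric spaces. A decomposition $X=\bigcup_{j\in J}U_j$ of a metric space is $r$-disjoint if $d(U_i,U_j)>r$ for all $i\neq j$ in $J$. A metric family $\{X_i\}_{i\in I}$ has finite asymptotic dimension uniformly if there exists $m\in\mathbb{N}$ such that for every $r>0$ and every $i\in I$ there are decompositions $X_i=\bigcup_{k=0}^mU_i^k$ and $r$-disjoint decompositions $U_i^k=\bigcup_{j\in J_{i,k}}U_{i,j}^k$ such that (for each fixed $r$) $\sup_{i,j,k}\mathrm{diam}\,U_{i,j}^k<\infty$. *)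

(* Defs.v *)
From HB Require Import structures.
From mathcomp Require Import all_boot all_order all_algebra.
From mathcomp Require Import all_classical all_reals all_analysis.

Set Implicit Arguments.
Unset Strict Implicit.
Unset Printing Implicit Defensive.

Import Order.TTheory GRing.Theory Num.Theory.

Local Open Scope classical_set_scope.
Local Open Scope ring_scope.

(* Subgroups of a possibly infinite group are the library's [groupClosed]
   predicates. *)

Definition subgroup_type (gT : groupType) (G : groupClosed gT) : Type :=
  {x : gT | x \in G}.

Section SubgroupType.
Variables (gT : groupType) (G : groupClosed gT).

HB.instance Definition _ := SubChoice.on (subgroup_type G).

Fact subgroup_type_closed : group_closed (fun x : gT => x \in G).
Proof. by split=> [|x y Gx Gy]; [exact: gpred1 | exact: gpredF]. Qed.

HB.instance Definition _ := SubChoice_isSubGroup.Build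
  gT (fun x : gT => x \in G) (subgroup_type G) subgroup_type_closed.

End SubgroupType.

Definition finitely_generated (G : groupType) : Prop :=
  exists S : seq G, forall H : groupClosed G,
    {subset S <= H} -> forall x : G, x \in H.

(* The library's 'GL_n[R] requires a finite ring R and n > 0. *)
Definition GL (K : fieldType) (n : nat) : Type := {A : 'M[K]_n | A \in unitmx}.

Section GeneralLinearGroup.
Variables (K : fieldType) (n : nat).

HB.instance Definition _ := SubChoice.on (GL K n).

Definition GL_one : GL K n := exist _ 1%:M (unitmx1 K n).

Fact GL_mul_subproof (A B : GL K n) : val A *m val B \in unitmx.
Proof. by rewrite unitmx_mul (valP A) (valP B). Qed.
Definition GL_mul (A B : GL K n) : GL K n :=
  exist (fun C => C \in unitmx) _ (GL_mul_subproof A B).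

Fact GL_inv_subproof (A : GL K n) : invmx (val A) \in unitmx.
Proof. by rewrite unitmx_inv (valP A). Qed.
Definition GL_inv (A : GL K n) : GL K n :=
  exist (fun C => C \in unitmx) _ (GL_inv_subproof A).

Fact GL_mulA : associative GL_mul.
Proof. by move=> A B C; apply: val_inj; exact: mulmxA. Qed.

Fact GL_mul1 : left_id GL_one GL_mul.
Proof. by move=> A; apply: val_inj; exact: mul1mx. Qed.

Fact GL_mulr1 : right_id GL_one GL_mul.
Proof. by move=> A; apply: val_inj; exact: mulmx1. Qed.

Fact GL_mulV : left_inverse GL_one GL_inv GL_mul.
Proof. by move=> A; apply: val_inj; exact: mulVmx (valP A). Qed.

Fact GL_mulrV : right_inverse GL_one GL_inv GL_mul.
Proof. by move=> A; apply: val_inj; exact: mulmxV (valP A). Qed.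

HB.instance Definition _ := isGroup.Build (GL K n)
  GL_mulA GL_mul1 GL_mulr1 GL_mulV GL_mulrV.

End GeneralLinearGroup.

Record left_invariant_metric (R : realType) (G : groupType) :=
    LeftInvariantMetric {
  lmdist :> G -> G -> R ;
  lmdistxx : forall x, lmdist x x = 0 ;
  lmdist_positivity : forall x y, lmdist x y = 0 -> x = y ;
  lmdist_sym : forall x y, lmdist x y = lmdist y x ;
  lmdist_triangle : forall y x z, lmdist x z <= lmdist x y + lmdist y z ;
  lmdist_linv : forall g h h', lmdist (g * h)%g (g * h')%g = lmdist h h' }.

Definition proper_metric (R : realType) (G : groupType)
    (d : left_invariant_metric R G) : Prop :=
  forall (x : G) (r : R), finite_set [set y | d x y <= r].

Record finite_subgroup (G : groupType) := FiniteSubgroup {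
  fsubgroup :> groupClosed G ;
  fsubgroup_finite : finite_set [set` fsubgroup] }.

Definition rcoset (G : groupType) (F : finite_subgroup G) (g : G) : set G :=
  [set (f * g)%g | f in [set` F]].

(* The set F \ G of the cosets F g; it does not depend on d, but its metric
   structure below does. *)
Definition quotient_space (R : realType) (G : groupType)
    (d : left_invariant_metric R G) (F : finite_subgroup G) : Type :=
  set_type (range (rcoset F)).

Section QuotientSpace.
Variables (R : realType) (G : groupType).
Variables (d : left_invariant_metric R G) (F : finite_subgroup G).
Local Notation Q := (quotient_space d F).
Implicit Types (f g h : G) (X Y Z : Q).

HB.instance Definition _ := Choice.copy Q (set_type (range (rcoset F))).

Definition to_quotient (g : G) : Q :=
  exist _ (rcoset F g) (mem_set (imageT (rcoset F) g)).

Fact quotient_repr_subproof X : exists g, rcoset F g = sval X.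
Proof. by case: (set_mem (valP X)) => g _ gX; exists g. Qed.

Definition quotient_repr X : G := sval (cid (quotient_repr_subproof X)).

(* d(F g, F h) = min_(f in F) d(g, f h), on chosen representatives; see
   [quotient_distE] and [quotient_dist_min] below. *)
Definition quotient_dist X Y : R :=
  inf [set d (quotient_repr X) (f * quotient_repr Y)%g | f in [set` F]].

Lemma quotient_reprK X : to_quotient (quotient_repr X) = X.
Proof.
by apply: val_inj; rewrite /= /quotient_repr; case: cid.
Qed.

Lemma lmdist_ge0 x y : 0 <= d x y.
Proof.
rewrite -(@pmulrn_lge0 _ _ 2)// -(lmdistxx d x).
by rewrite (le_trans (lmdist_triangle d y _ _))// (lmdist_sym d y) -mulr2n.
Qed.

Lemma repr_to_quotient g :
  exists2 f, f \in F & quotient_repr (to_quotient g) = (f * g)%g.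
Proof.
rewrite /quotient_repr; case: cid => x /= xg.
have : rcoset F x x by exists 1%g; [exact: gpred1 | rewrite mul1g].
by rewrite xg => -[f Ff <-]; exists f.
Qed.

Let D g h := [set d g (f * h)%g | f in [set` F]].

Lemma min_dist g h :
  exists2 f, f \in F & inf (D g h) = d g (f * h)%g.
Proof.
have D0 : D g h !=set0 by exists (d g (1 * h)%g), 1%g => //; exact: gpred1.
have finD : finite_set (D g h) by apply: finite_image; exact: fsubgroup_finite.
have lbD : has_lbound (D g h) by exists 0 => _ [f _ <-]; exact: lmdist_ge0.
suff [m Dm mle] : exists2 m, D g h m & lbound (D g h) m.
  case: Dm => f Ff fm; exists f => //; rewrite fm.
  apply/eqP; rewrite eq_le; apply/andP; split; last exact: lb_le_inf.
  by apply: ge_inf => //; exists f.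
move: finD D0; move: (D g h) => A /finite_setP[k].
elim: k A => [|k IH] A.
  by rewrite II0 card_eq0 => /eqP -> [].
move=> /eq_cardSP[x Ax cA] _.
have [A0|/set0P A0] := eqVneq (A `\ x) set0.
  exists x => // y Ay; have [->//|/eqP yx] := eqVneq y x.
  by have : (A `\ x) y by []; rewrite A0.
have [m [Am _] mle] := IH _ cA A0.
have [xm|mx] := leP x m.
  exists x => // y Ay; have [->//|/eqP yx] := eqVneq y x.
  by apply: le_trans xm _; apply: mle.
exists m => // y Ay; have [->|/eqP yx] := eqVneq y x; first exact: ltW.
exact: mle.
Qed.

Lemma quotient_distE g h : quotient_dist (to_quotient g) (to_quotient h) =
  inf [set d g (f * h)%g | f in [set` F]].
Proof.
rewrite /quotient_dist; have [a Fa ->] := repr_to_quotient g.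
have [b Fb ->] := repr_to_quotient h; congr inf.
apply/seteqP; split=> _ [f Ff <-].
  exists (a^-1 * f * b)%g; first by rewrite /= !gpredM ?gpredV.
  by rewrite -(lmdist_linv d a) !mulgA mulgV mul1g.
exists (a * f * b^-1)%g; first by rewrite /= !gpredM ?gpredV.
by rewrite -!mulgA mulKg lmdist_linv.
Qed.

Lemma quotient_dist_min g h :
  (exists2 f, f \in F &
     quotient_dist (to_quotient g) (to_quotient h) = d g (f * h)%g) /\
  (forall f, f \in F ->
     quotient_dist (to_quotient g) (to_quotient h) <= d g (f * h)%g).
Proof.
rewrite quotient_distE; split; first exact: min_dist.
move=> f Ff; apply: ge_inf; last by exists f.
by exists 0 => _ [? _ <-]; exact: lmdist_ge0.
Qed.

Lemma quotient_dist_ge0 X Y : 0 <= quotient_dist X Y.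
Proof.
rewrite -(quotient_reprK X) -(quotient_reprK Y).
have [[f _ ->] _] := quotient_dist_min (quotient_repr X) (quotient_repr Y).
exact: lmdist_ge0.
Qed.

Lemma quotient_distxx X : quotient_dist X X = 0.
Proof.
apply/eqP; rewrite eq_le quotient_dist_ge0 andbT -(quotient_reprK X).
have [_ /(_ 1%g gpred1)] :=
  quotient_dist_min (quotient_repr X) (quotient_repr X).
by rewrite mul1g lmdistxx.
Qed.

Lemma quotient_dist_positivity X Y : quotient_dist X Y = 0 -> X = Y.
Proof.
rewrite -(quotient_reprK X) -(quotient_reprK Y).
move: (quotient_repr X) (quotient_repr Y) => g h.
have [[f Ff ->] _] := quotient_dist_min g h.
move/lmdist_positivity => ->; apply: val_inj => /=.
apply/seteqP; split=> _ [a Fa <-].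
  by exists (a * f)%g; rewrite /= ?gpredM// mulgA.
by exists (a * f^-1)%g; rewrite /= ?gpredM ?gpredV// mulgA mulgVK.
Qed.

Lemma quotient_dist_sym X Y : quotient_dist X Y = quotient_dist Y X.
Proof.
suff le Z T : quotient_dist Z T <= quotient_dist T Z.
  by apply/eqP; rewrite eq_le !le.
rewrite -(quotient_reprK Z) -(quotient_reprK T).
move: (quotient_repr Z) (quotient_repr T) => g h.
have [[f Ff ->] _] := quotient_dist_min h g.
rewrite -(lmdist_linv d f^-1%g) mulKg lmdist_sym.
by have [_] := quotient_dist_min g h; apply; rewrite gpredV.
Qed.

Lemma quotient_dist_triangle Y X Z :
  quotient_dist X Z <= quotient_dist X Y + quotient_dist Y Z.
Proof.
rewrite -(quotient_reprK X) -(quotient_reprK Y) -(quotient_reprK Z).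
move: (quotient_repr X) (quotient_repr Y) (quotient_repr Z) => g h k.
have [[a Fa ->] _] := quotient_dist_min g h.
have [[b Fb ->] _] := quotient_dist_min h k.
have [_ /(_ (a * b)%g)] := quotient_dist_min g k.
rewrite gpredM// => /(_ isT)/le_trans; apply.
rewrite -[X in _ + X](lmdist_linv d a) -mulgA.
exact: lmdist_triangle.
Qed.

HB.instance Definition _ := isMetric.Build R Q quotient_distxx
  quotient_dist_positivity quotient_dist_sym quotient_dist_triangle.

Lemma mdist_quotientE X Y : mdist X Y = quotient_dist X Y.
Proof. by []. Qed.

End QuotientSpace.

(* With this convention the diameter of the empty set is -oo. *)
Definition diam (R : realType) (X : metricType R) (U : set X) : \bar R :=
  ereal_sup [set (mdist x y)%:E | x in U & y in U].

(* The distance to the empty set is +oo. *)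
Definition set_dist (R : realType) (X : metricType R) (U V : set X) : \bar R :=
  ereal_inf [set (mdist x y)%:E | x in U & y in V].

Definition decomposition (T J : Type) (X : set T) (U : J -> set T) : Prop :=
  X = \bigcup_j U j.

Definition r_disjoint (R : realType) (X : metricType R) (r : R) (J : Type)
    (U : J -> set X) : Prop :=
  forall i j, i <> j -> (r%:E < set_dist (U i) (U j))%E.

Definition uniformly_finite_asdim (R : realType) (I : Type)
    (X : I -> metricType R) : Prop :=
  exists m : nat, forall r : R, 0 < r ->
  exists (U : forall i, 'I_m.+1 -> set (X i))
         (J : I -> 'I_m.+1 -> Type)
         (V : forall i k, J i k -> set (X i)),
  [/\ forall i, decomposition setT (U i),
      forall i k, decomposition (U i k) (V i k),
      forall i k, r_disjoint r (V i k)
    & (ereal_sup [set e | exists i k j, e = diam (V i k j)] < +oo)%E].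

(* Main.v *)
(* By Noether normalization the entries of the generators of G are integral over
   a polynomial ring A = F_p[t_1, ..., t_d], so the regular representation embeds
   G into GL_M(L), L = Frac A, with entries in (1/f)A for a single f <> 0. Hence
   the single valuation of L given by the total degree already makes
   ln max(|g|, |g^-1|) a proper length function on G.
   Specializing A at a point where f does not vanish, with values in a finite
   field, gives a homomorphism pi from G to a finite group whose kernel has only
   p-power torsion. For F finite, F :&: ker pi is thus a p-group and can be
   conjugated into the unitriangular matrices. The absolute values of the diagonal
   of the Iwasawa decomposition then give 1-Lipschitz coordinates, invariant under
   F :&: ker pi, along which every r-chain that keeps the coordinates bounded is
   itself bounded, because the norm is ultrametric. As F :&: ker pi has bounded
   index in F, symmetrizing these coordinates over F makes them F-invariant, with
   a number of coordinates independent of F. Finally F \ G is covered by the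
   r-components of preimages of cubes, colored by the parity of the cubes. *)
Require Import Defs.
From HB Require Import structures.
From Stdlib Require Import Relation_Operators Operators_Properties.
From mathcomp Require Import all_boot all_order all_algebra all_fingroup all_solvable all_field all_character.
From mathcomp Require Import zify ring lra.
From mathcomp Require mpoly boolp.

Set Implicit Arguments.
Unset Strict Implicit.
Unset Printing Implicit Defensive.

Import Order.TTheory GRing.Theory Num.Theory.

Local Open Scope ring_scope.

(** * Noether normalization over a finite field *)

Module Noether.
Import mpoly.

Lemma digits_inj (B k : nat) (u v : 'I_k -> nat) :
    (forall i, u i < B)%N -> (forall i, v i < B)%N ->
  (\sum_(i < k) u i * B ^ i = \sum_(i < k) v i * B ^ i)%N -> u =1 v.
Proof.
elim: k u v => [|k IH] u v uB vB; first by move=> _ [].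
rewrite !big_ord_recl /= !expn0 !muln1 => E.
have shift (w : 'I_k.+1 -> nat) : (\sum_(i < k) w (lift ord0 i) * B ^ bump 0 i =
    B * \sum_(i < k) w (lift ord0 i) * B ^ i)%N.
  by rewrite big_distrr /=; apply: eq_bigr => i _; rewrite expnS mulnCA.
move: E; rewrite !shift => E.
have B0 : (0 < B)%N by exact: leq_ltn_trans (uB ord0).
have u0 : u ord0 = v ord0.
  have := congr1 (modn^~ B) E.
  by rewrite ![(B * _)%N]mulnC !(addnC (_ ord0)) !modnMDl !modn_small.
move/eqP: E; rewrite u0 eqn_add2l eqn_pmul2l // => /eqP E i.
case: (unliftP ord0 i) => [j ->|->//].
by apply: (IH (fun j => u (lift ord0 j)) (fun j => v (lift ord0 j))).
Qed.

Lemma seq_argmax (T : eqType) (f : T -> nat) (s : seq T) :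
  s != [::] -> exists2 m, m \in s & forall m', m' \in s -> (f m' <= f m)%N.
Proof.
elim: s => // x [|y s] IH _.
  by exists x; rewrite ?mem_seq1 // => m'; rewrite mem_seq1 => /eqP->.
have [//|m ms mP] := IH; have [le|lt] := leqP (f m) (f x).
  exists x; first exact: mem_head.
  by move=> m'; rewrite in_cons => /orP[/eqP->//|/mP/leq_trans]; apply.
exists m; first by rewrite in_cons ms orbT.
by move=> m'; rewrite in_cons => /orP[/eqP->|/mP//]; exact: ltnW.
Qed.

(* Nagata's trick: the exponents [B ^ i] give distinct weights to the
   monomials of [P], so a single one governs the leading term. *)
Lemma nagata (F : fieldType) (n : nat) (P : {mpoly F[n]}) : P != 0 ->
  exists (B : nat) (m0 : 'X_{1..n}), P@_m0 != 0 /\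
  forall (K : idomainType) (f : {rmorphism F -> K}) (z : 'I_n -> K),
  let Q := mmap (polyC \o f) (fun i => (z i)%:P + 'X^(B ^ i)) P in
  size Q = (\sum_(i < n) m0 i * B ^ i).+1 /\ lead_coef Q = f P@_m0.
Proof.
move=> P0.
(* [B] exceeds every exponent in [P], so the exponents of [m] are the base-[B] digits of [wt m]. *)
pose B := (\max_(m <- msupp P) \max_(i < n) m i).+2.
pose wt (m : 'X_{1..n}) := (\sum_(i < n) m i * B ^ i)%N.
have mB m i : m \in msupp P -> (m i < B)%N.
  move=> mP; rewrite ltnS; apply: leqW.
  apply: (@leq_trans (\max_(i < n) m i)); first exact: leq_bigmax_cond.
  exact: (@leq_bigmax_seq _ _ xpredT (fun m : 'X_{1..n} => \max_(i < n) m i)%N).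
have wt_inj : {in msupp P &, injective wt}.
  move=> m m' mP m'P /digits_inj E; apply/mnmP; apply: E => i; exact: mB.
have [|m0 m0P m0max] := @seq_argmax _ wt (msupp P); first by rewrite msupp_eq0.
exists B, m0; split; first by rewrite -mcoeff_msupp.
move=> K f z Q.
pose T (m : 'X_{1..n}) := \prod_(i < n) ((z i)%:P + 'X^(B ^ i)) ^+ (m i) : {poly K}.
have szf i : size ((z i)%:P + 'X^(B ^ i)) = (B ^ i).+1.
  by rewrite addrC size_XnaddC // expn_gt0.
have monf i : (z i)%:P + 'X^(B ^ i) \is monic.
  by rewrite addrC monicXnaddC // expn_gt0.
have monT m : T m \is monic by apply: monic_prod => i _; exact: monic_exp.
have szT m : size (T m) = (wt m).+1.
  rewrite /T size_prod; last by move=> i _; rewrite monic_neq0 ?monic_exp.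
  have E i : size (((z i)%:P + 'X^(B ^ i)) ^+ m i) = (m i * B ^ i).+1.
    by rewrite -[LHS]prednK ?size_poly_gt0 ?monic_neq0 ?monic_exp //
      size_exp szf mulnC.
  rewrite (eq_bigr (fun i => 1 + m i * B ^ i)%N); last by move=> i _; rewrite E.
  by rewrite big_split /= sum1_card -addnS addKn.
have QE : Q = (f P@_m0)%:P * T m0 +
    \sum_(m <- rem m0 (msupp P)) (f P@_m)%:P * T m.
  by rewrite /Q /mmap (big_rem m0).
have c0 : f P@_m0 != 0 by rewrite fmorph_eq0 -mcoeff_msupp.
have sz0 : size ((f P@_m0)%:P * T m0) = (wt m0).+1.
  by rewrite mul_polyC size_scale // szT.
have lt : (size (\sum_(m <- rem m0 (msupp P)) (f P@_m)%:P * T m)%R <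
    size ((f P@_m0)%:P * T m0)%R)%N.
  rewrite sz0 ltnS; apply: (leq_trans (size_sum _ _ _)).
  rewrite big_seq; apply: (big_ind (fun k => (k <= wt m0)%N)) => // [a b|m].
    by rewrite geq_max => -> ->.
  rewrite mem_rem_uniq ?msupp_uniq // inE => /andP[/= mm0 mP]; rewrite mul_polyC.
  apply: (leq_trans (size_scale_leq _ _)); rewrite szT ltn_neqAle m0max // andbT.
  by apply: contraNneq mm0 => /wt_inj -> .
by rewrite QE size_polyDl // lead_coefDl // sz0 mul_polyC lead_coefZ (monicP (monT _)) mulr1.
Qed.

Lemma prime_field_morph (R : nzRingType) (p : nat) :
  p \in [pchar R] -> exists f : {rmorphism 'F_p -> R}, True.
Proof.
move=> hp.
pose f : {rmorphism 'F_p -> pPrimeCharType hp} := in_alg (pPrimeCharType hp).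
by exists f.
Qed.

Section Eval.
Variables (F : fieldType) (K : comNzRingType) (f : {rmorphism F -> K}).

Lemma horner_mmap n (B : nat) (z : 'I_n -> K) (x : K) (P : {mpoly F[n]}) :
  (mmap (polyC \o f) (fun i => (z i)%:P + 'X^(B ^ i)) P).[x] =
  mmap f (fun i => z i + x ^+ (B ^ i)) P.
Proof.
rewrite /mmap horner_sum; apply: eq_bigr => m _.
rewrite /mmap1 hornerM hornerC; congr (_ * _).
by rewrite horner_prod; apply: eq_bigr => i _; rewrite !hornerE.
Qed.

End Eval.

Section Normalization.
Variables (F K : fieldType) (f : {rmorphism F -> K}).

Local Notation ev y := (mmap f y).

(** With [z j = y j - y 0 ^+ (B ^ j)] for positive [j], [nagata] turns the relation [P] into an
    equation for [y 0] over [F[z]] whose leading coefficient is a nonzero constant. So [y 0], and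
    with it every [y j], is integral over [F[z]]. *)
Lemma noether_step n (y : 'I_n -> K) (P : {mpoly F[n]}) :
    P != 0 -> ev y P = 0 ->
  exists (k : nat), n = k.+1 /\ exists z : 'I_k -> K,
    forall i, integralOver (ev z) (y i).
Proof.
move=> P0; have [B [m0 [c0 nag]]] := nagata P0.
case: n y P P0 m0 c0 nag => [|k] y P P0 m0 c0 nag.
  have [] := nag K f y; set Q := mmap _ _ _; rewrite big_ord0 => sz lead.
  move=> evP.
  have : Q.[0] = 0.
    by rewrite /Q horner_mmap -{}evP /mmap; apply: eq_bigr => m _; rewrite /mmap1 !big_ord0.
  have [q Qq] : exists q, Q = q%:P by exists Q`_0; apply: size1_polyC; rewrite sz.
  move: lead; rewrite Qq hornerC lead_coefC => -> /eqP.
  by rewrite fmorph_eq0 (negbTE c0).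
move=> evP; exists k; split=> //.
set y0 := y ord0.
pose z j := y (lift ord0 j) - y0 ^+ (B ^ (lift ord0 j)).
exists z.
(* Index 0 gets the value 0 because [y0 = 0 + y0 ^+ (B ^ 0)]: one formula then covers every
   [y i]. *)
pose X' (i : 'I_k.+1) : {mpoly F[k]} := if unlift ord0 i is Some j then 'X_j else 0.
pose z' i := ev z (X' i).
have yE i : y i = z' i + y0 ^+ (B ^ i).
  rewrite /z' /X'; case: unliftP => [j ->|->].
    by rewrite mmapX mmap1U /z subrK.
  by rewrite mmap0 add0r expn0 expr1.
have int0 : integralOver (ev z) y0.
  have := nag {mpoly F[k]} (@mpolyC k F) X'.
  set Q := mmap _ _ _ => -[sz lead].
  exists ((P@_m0)^-1%:MP *: Q).
    by rewrite monicE lead_coefZ lead -mpolyCM mulVf // mpolyC1.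
  rewrite map_polyZ /= rootZ; last by rewrite mmapC fmorph_eq0 invr_eq0.
  rewrite /root; apply/eqP.
  have -> : map_poly (ev z) Q = mmap (polyC \o f) (fun i => (z' i)%:P + 'X^(B ^ i)) P.
    have -> : Q = \sum_(m <- msupp P) (polyC \o @mpolyC k F) P@_m *
      mmap1 (fun i => (X' i)%:P + 'X^(B ^ i)) m by [].
    rewrite rmorph_sum [RHS]/mmap; apply: eq_bigr => m _.
    rewrite rmorphM /= map_polyC /= mmapC; congr (_ * _).
    rewrite rmorph_prod; apply: eq_bigr => i _.
    by rewrite rmorphXn rmorphD /= map_polyC map_polyXn.
  rewrite horner_mmap -[RHS]evP /mmap; apply: eq_bigr => m _.
  rewrite /mmap1; congr (_ * _).
  by apply: eq_bigr => i _; rewrite -yE.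
move=> i; rewrite yE; apply: integral_add; first exact: integral_id.
elim: (B ^ i)%N => [|e IH]; first by rewrite expr0; exact: integral1.
by rewrite exprS; apply: integral_mul.
Qed.

(** Induction on the number of elements, starting from [xs] itself: as long as they are
    algebraically dependent, [noether_step] saves one of them, and integrality is transitive. *)
Lemma noether_normalization (xs : seq K) : exists n (y : 'I_n -> K),
  injective (ev y) /\ forall x, x \in xs -> integralOver (ev y) x.
Proof.
have : exists n (y : 'I_n -> K), forall x, x \in xs -> integralOver (ev y) x.
  exists (size xs), (fun i => xs`_i) => x xxs.
  have ix : (index x xs < size xs)%N by rewrite index_mem.
  have -> : x = mmap f (fun i : 'I_(size xs) => xs`_i) 'X_(Ordinal ix).
    by rewrite mmapX mmap1U /= nth_index.
  exact: integral_id.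
case=> n; elim: n => [|n IH] [y yint].
  exists 0%N, y; split=> // a b ab; apply/eqP; rewrite -subr_eq0.
  apply/negPn/negP => ab0; have [] := @noether_step _ y (a - b) ab0.
    by rewrite mmapB ab subrr.
  by move=> k [].
have [inj|ninj] := boolp.EM (injective (ev y)); first by exists n.+1, y.
have [P P0 evP] : exists2 P, P != 0 & ev y P = 0.
  apply: boolp.contrapT => noP; apply: ninj => a b ab.
  apply/eqP; rewrite -subr_eq0; apply/negPn/negP => ab0.
  by case: noP; exists (a - b) => //; rewrite mmapB ab subrr.
have [k [[nk]]] := noether_step P0 evP; case: k / nk => -[z zint].
apply: IH; exists z => x /yint[q qmon qx].
apply: (integral_root_monic _ qx); first exact: monic_map.
move=> c /(nthP 0)[l _ <-]; rewrite coef_map /= /mmap.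
apply: (big_ind (integralOver (ev z))); [exact: integral0|exact: integral_add|].
move=> m _; apply: integral_mul.
  by rewrite -(mmapC z f); exact: integral_id.
apply: (big_ind (integralOver (ev z))); [exact: integral1|exact: integral_mul|].
move=> i _; elim: (m i) => [|e IHe]; first by rewrite expr0; exact: integral1.
by rewrite exprS; apply: integral_mul.
Qed.

End Normalization.

(* Kronecker substitution [X_i := x ^ (B ^ i)] reduces to one variable. *)
Lemma specialization p n (P : {mpoly 'F_p[n]}) : prime p -> P != 0 ->
  exists (k : finFieldType) (s : {rmorphism {mpoly 'F_p[n]} -> k}), s P != 0.
Proof.
move=> pp P0; have [B [m0 [c0 nag]]] := nagata P0.
(* The sum is the degree of [Q] below; with the exponent one larger, the field has more elements
   than [Q] has roots. *)
have [k chk cardk] := pPrimePowerField pp (ltn0Sn (\sum_(i < n) m0 i * B ^ i)).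
have [f _] := prime_field_morph chk.
have [] := nag k f (fun=> 0); set Q := mmap _ _ _ => sz lead.
have Q0 : Q != 0 by rewrite -size_poly_gt0 sz.
have [x Qx] : exists x, ~~ root Q x.
  apply/existsP; apply: contraT; rewrite negb_exists => /forallP allr.
  have := max_poly_roots Q0 (rs := enum k).
  rewrite enum_uniq -cardE cardk sz.
  have -> : all (root Q) (enum k) by apply/allP => x _; rewrite -[root _ _]negbK allr.
  move=> /(_ isT isT); rewrite ltnS leqNgt.
  suff -> : (\sum_(i < n) m0 i * B ^ i < p ^ (\sum_(i < n) m0 i * B ^ i).+1)%N by [].
  apply: ltn_trans (ltnSn _) _; apply: ltn_expl; exact: prime_gt1.
exists k, (mmap f (fun i => 0 + x ^+ (B ^ i))).
by rewrite /= -horner_mmap.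
Qed.

(** The properties of polynomial rings over ['F_p] behind the metric and the finite quotient: the
    exponential of the degree is an ultrametric absolute value with finite balls, and a nonzero
    element survives in some finite field. *)
Record degree_ring (A : idomainType) (deg : A -> nat) : Prop := DegreeRing {
  deg_mul : forall a b, a != 0 -> b != 0 -> deg (a * b) = (deg a + deg b)%N;
  deg_add : forall a b : A, (deg (a + b)%R <= maxn (deg a) (deg b))%N;
  deg_finite : forall n, exists s : seq A, forall a, (deg a <= n)%N -> a \in s;
  deg_specialize : forall a, a != 0 ->
    exists (k : finFieldType) (s : {rmorphism A -> k}), s a != 0 }.

(** [msize] is the total degree plus one, and 0 at the zero polynomial. Finiteness holds because a
    polynomial of bounded degree is a function from a finite set of monomials to ['F_p]. *)
Lemma mpoly_degree_ring p n : prime p ->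
  degree_ring (fun P : {mpoly 'F_p[n]} => (msize P).-1).
Proof.
move=> pp; split=> [a b a0 b0|a b|d|a]; last exact: specialization.
- rewrite msizeM // -[in LHS](prednK (n := msize a)) ?lt0n ?mmeasure_poly_eq0 //.
  by rewrite -[in LHS](prednK (n := msize b)) ?lt0n ?mmeasure_poly_eq0 // addSn addnS.
- have /= := msizeD_le a b; move: (msize _) (msize _) (msize _) => i j l; lia.
- pose g (h : {ffun 'X_{1..n < d.+1} -> 'F_p}) : {mpoly 'F_p[n]} :=
    \sum_m h m *: 'X_[bmnm m].
  exists [seq g h | h <- enum {ffun 'X_{1..n < d.+1} -> 'F_p}] => a ad.
  apply/mapP; exists [ffun m => a@_(bmnm m)]; first by rewrite mem_enum.
  rewrite {1}(@mpolywE _ _ d.+1 a); last exact: leq_trans (leqSpred _) _.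
  by apply: eq_bigr => m _; rewrite ffunE.
Qed.

Theorem noether_degree (K : fieldType) (p : nat) (xs : seq K) : p \in [pchar K] ->
  exists (A : idomainType) (iota : {rmorphism A -> K}) (deg : A -> nat),
  [/\ injective iota, degree_ring deg & forall x, x \in xs -> integralOver iota x].
Proof.
move=> hp; have [f _] := prime_field_morph hp.
have [n [y [inj int]]] := noether_normalization f xs.
exists {mpoly 'F_p[n]}, (mmap f y), (fun P => (msize P).-1); split=> //.
by apply: mpoly_degree_ring; exact: pcharf_prime hp.
Qed.

End Noether.

(** * The regular representation *)

Section Span.
Variables (A : idomainType) (K : fieldType) (iota : {rmorphism A -> K}).
Hypothesis iota_inj : injective iota.

(** The [A]-submodule of [K] generated by [ms], as an inductive predicate to avoid carrying
    coefficient vectors. *)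
Inductive aspan (ms : seq K) : K -> Prop :=
| aspan0 : aspan ms 0
| aspan_cons a m x : m \in ms -> aspan ms x -> aspan ms (iota a * m + x).

Lemma aspan_mem ms m : m \in ms -> aspan ms m.
Proof.
by move=> mms; rewrite -[m]addr0 -[m]mul1r -(rmorph1 iota); apply: aspan_cons => //; exact: aspan0.
Qed.

Lemma aspanD ms x y : aspan ms x -> aspan ms y -> aspan ms (x + y).
Proof.
by elim=> [|a m {}x mms _ IH] sy; rewrite ?add0r // -addrA; apply: aspan_cons => //; exact: IH.
Qed.

Lemma aspanZ ms a x : aspan ms x -> aspan ms (iota a * x).
Proof.
elim=> [|b m {}x mms _ IH]; first by rewrite mulr0; exact: aspan0.
by rewrite mulrDr mulrA -rmorphM; exact: aspan_cons.
Qed.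

Lemma aspanN ms x : aspan ms x -> aspan ms (- x).
Proof. by rewrite -mulN1r -(rmorph1 iota) -rmorphN; exact: aspanZ. Qed.

Lemma aspan_sum ms (I : Type) (r : seq I) (F : I -> K) :
  (forall i, aspan ms (F i)) -> aspan ms (\sum_(i <- r) F i).
Proof.
by move=> FP; apply: big_ind => //; [exact: aspan0|exact: aspanD].
Qed.

Lemma aspan_trans ms ms' r x : (forall m, m \in ms -> aspan ms' (r * m)) ->
  aspan ms x -> aspan ms' (r * x).
Proof.
move=> sub; elim=> [|a m {}x mms _ IH]; first by rewrite mulr0; exact: aspan0.
by rewrite mulrDr mulrCA; apply: aspanD => //; apply: aspanZ; exact: sub.
Qed.

Lemma aspan_sub ms ms' x : {subset ms <= ms'} -> aspan ms x -> aspan ms' x.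
Proof.
by move=> sub; rewrite -{2}[x]mul1r; apply: aspan_trans => m /sub; rewrite mul1r; exact: aspan_mem.
Qed.

Definition stabilizes ms r := forall m, m \in ms -> aspan ms (r * m).

(** If [x] is a root of a monic polynomial of degree [d], multiplying a stable family by the powers
    [x ^+ i] with [i < d] makes it stable under [x], and it stays stable under the earlier elements
    by commutativity. *)
Lemma integral_stable (xs : seq K) : (forall x, x \in xs -> integralOver iota x) ->
  exists ms, 1 \in ms /\ forall x, x \in xs -> stabilizes ms x.
Proof.
elim: xs => [|x xs IH] int; first by exists [:: 1]; split=> //; rewrite mem_head.
have [|ms [ms1 st]] := IH.
  by move=> y yxs; apply: int; rewrite in_cons yxs orbT.
have [q qmon qx] := int x (mem_head _ _).
pose d := (size q).-1.
have szq : size q = d.+1 by rewrite prednK // size_poly_gt0 monic_neq0.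
(* A monic constant is 1 and has no root. Positivity of [d] keeps 1 in the new family. *)
have d0 : (0 < d)%N.
  rewrite lt0n; apply: contraL qx => /eqP d0.
  have [c qc] : exists c, q = c%:P by exists q`_0; apply: size1_polyC; rewrite szq d0.
  move: qmon; rewrite qc monicE lead_coefC map_polyC rootC => /eqP->.
  by apply/negP => /eqP i1; have := oner_neq0 K; rewrite -(rmorph1 iota) => /eqP; apply.
have xd : x ^+ d = - \sum_(i < d) iota q`_i * x ^+ i.
  apply/eqP; rewrite -addr_eq0; apply/eqP.
  have := rootP qx; rewrite horner_coef size_map_poly_id0; last first.
    by rewrite (monicP qmon) rmorph1 oner_neq0.
  rewrite szq big_ord_recr /= !coef_map /=.
  have -> : q`_d = 1 by rewrite -(monicP qmon) lead_coefE szq.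
  rewrite rmorph1 mul1r addrC => E; rewrite -[RHS]E; congr (_ + _).
  by apply: eq_bigr => i _; rewrite coef_map.
pose ns := [seq x ^+ i * m | i <- seq.iota 0 d, m <- ms].
have nsP i m : (i < d)%N -> m \in ms -> x ^+ i * m \in ns.
  by move=> id mms; apply: (allpairs_f (fun i m => x ^+ i * m)); rewrite ?mem_iota.
exists ns; split; first by rewrite -[1]mulr1 -{1}(expr0 x); exact: nsP.
move=> y; rewrite in_cons => /orP[/eqP ->|yxs] _ /allpairsP[[i m] /= [id mms ->]].
  move: id; rewrite mem_iota add0n => /= id.
  rewrite mulrA -exprS; have [lt|] := ltnP i.+1 d.
    by apply: aspan_mem; exact: nsP.
  move=> di; have -> : i.+1 = d by apply/eqP; rewrite eqn_leq di id.
  rewrite xd mulNr; apply: aspanN; rewrite mulr_suml; apply: aspan_sum => j.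
  by rewrite -mulrA; apply: aspanZ; apply: aspan_mem; exact: nsP.
move: id; rewrite mem_iota add0n => /= id.
rewrite mulrCA; apply: (aspan_trans (ms := ms)); last exact: st.
by move=> m' m'ms; apply: aspan_mem; exact: nsP.
Qed.

Definition independent (ws : seq K) := forall a : 'I_(size ws) -> A,
  \sum_(i < size ws) iota (a i) * ws`_i = 0 -> forall i, a i = 0.

Lemma aspan_coord (ws : seq K) x : aspan ws x ->
  exists a : 'I_(size ws) -> A, x = \sum_(i < size ws) iota (a i) * ws`_i.
Proof.
elim=> [|a m {}x mws _ [b ->]].
  by exists (fun=> 0); rewrite big1 // => i _; rewrite rmorph0 mul0r.
have im : (index m ws < size ws)%N by rewrite index_mem.
exists (fun i => (if i == Ordinal im then a else 0) + b i).
under [RHS]eq_bigr => i _ do rewrite rmorphD mulrDl.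
rewrite big_split /=; congr (_ + _).
rewrite (bigD1 (Ordinal im)) //= eqxx nth_index // big1 ?addr0 // => i /negbTE ->.
by rewrite rmorph0 mul0r.
Qed.

(** An element joins [ws] unless a nonzero multiple [a * m] is already in the span of [ws]; [f] is
    the product of these [a]. *)
Lemma exists_independent (ms : seq K) : exists (ws : seq K) (f : A),
  [/\ {subset ws <= ms}, independent ws, f != 0
    & forall m, m \in ms -> aspan ws (iota f * m)].
Proof.
elim: ms => [|m ms [ws [f [wsms ind f0 fP]]]].
  by exists [::], 1; split=> //; [move=> a _ [] | exact: oner_neq0].
have [[a [a0 am]]|noa] := boolp.EM (exists a, a != 0 /\ aspan ws (iota a * m)).
  exists ws, (f * a); split=> //; first by move=> w /wsms; rewrite in_cons orbC => ->.
    by rewrite mulf_neq0.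
  move=> m'; rewrite in_cons => /orP[/eqP ->|/fP fm'].
    by rewrite rmorphM -mulrA; exact: aspanZ.
  by rewrite [f * a]mulrC rmorphM -mulrA; exact: aspanZ.
exists (m :: ws), f; split=> //.
- by move=> w; rewrite !in_cons => /orP[->//|/wsms->]; rewrite orbT.
- move=> a; rewrite big_ord_recl /= => E.
  have a0 : a ord0 = 0.
    apply/eqP/negPn/negP => a0; apply: noa; exists (a ord0); split=> //.
    move/eqP: E; rewrite addr_eq0 => /eqP ->; apply: aspanN; apply: aspan_sum => i.
    by apply: aspanZ; apply: aspan_mem; exact: (mem_nth 0 (ltn_ord i)).
  move: E; rewrite a0 rmorph0 mul0r add0r => /(ind (fun i => a (lift ord0 i))) E i.
  by case: (unliftP ord0 i) => [j ->|-> //]; exact: E.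
- move=> m'; rewrite in_cons => /orP[/eqP ->|/fP].
    by apply: aspanZ; apply: aspan_mem; exact: mem_head.
  by apply: aspan_sub => w wws; rewrite in_cons wws orbT.
Qed.

(* The regular representation of a ring [R] of elements integral over [A]: the
   matrix of multiplication by [r] on a maximal [A]-independent family,
   multiplied by a common denominator [f]. *)
Lemma regular_representation (xs : seq K) :
    (forall x, x \in xs -> integralOver iota x) ->
  exists (N : nat) (f : A) (R : K -> Prop) (alpha : K -> 'M[A]_N),
  [/\ f != 0, [/\ forall x, x \in xs -> R x, R 1, forall r s, R r -> R s -> R (r - s)
         & forall r s, R r -> R s -> R (r * s)],
    alpha 1 = f%:M,
    forall r s, R r -> R s ->
      alpha (r - s) = alpha r - alpha s /\ f *: alpha (r * s) = alpha r *m alpha s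
  & forall r, R r -> alpha r = 0 -> r = 0].
Proof.
move=> /integral_stable[ms [ms1 st]].
have [ws [f [wsms ind f0 fP]]] := exists_independent ms.
have R1 : stabilizes ms 1 by move=> m mms; rewrite mul1r; exact: aspan_mem.
have RB r s : stabilizes ms r -> stabilizes ms s -> stabilizes ms (r - s).
  by move=> Rr Rs m mms; rewrite mulrBl; apply: aspanD; [|apply: aspanN]; auto.
have RM r s : stabilizes ms r -> stabilizes ms s -> stabilizes ms (r * s).
  by move=> Rr Rs m mms; rewrite -mulrA; apply: aspan_trans Rr _; auto.
pose N := size ws.
pose rel r (a : 'M[A]_N) := forall i : 'I_N,
  iota f * (r * ws`_i) = \sum_j iota (a i j) * ws`_j.
have relP r : stabilizes ms r -> exists a, rel r a.
  move=> Rr; have co i : exists a : 'I_N -> A,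
      iota f * (r * ws`_(i : 'I_N)) = \sum_j iota (a j) * ws`_j.
    apply: aspan_coord; apply: aspan_trans fP _; apply: Rr; apply: wsms; exact: mem_nth.
  have [a aP] := boolp.choice co.
  by exists (\matrix_(i, j) a i j) => i; rewrite aP; apply: eq_bigr => j _; rewrite mxE.
have rel_uniq r a b : rel r a -> rel r b -> a = b.
  move=> ra rb; apply/matrixP => i j; apply/eqP; rewrite -subr_eq0; apply/eqP.
  apply: (ind (fun j => a i j - b i j)).
  under eq_bigr => l _ do rewrite rmorphB mulrBl.
  by rewrite sumrB -[X in X - _]ra -[X in _ - X]rb subrr.
have [alpha alphaP] : exists alpha, forall r, stabilizes ms r -> rel r (alpha r).
  (* [alpha] has to be total; outside the ring of stabilizing elements it is 0. *)
  suff /boolp.choice[alpha aP] : forall r, exists a, stabilizes ms r -> rel r a by exists alpha.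
  move=> r; have [Rr|nR] := boolp.EM (stabilizes ms r); last by exists 0.
  by have [a aP] := relP _ Rr; exists a.
exists N, f, (stabilizes ms), alpha; split=> //.
- apply: (rel_uniq 1); first exact: alphaP.
  move=> i; rewrite mul1r (bigD1 i) //= mxE eqxx mulr1n big1 ?addr0 // => j.
  by rewrite mxE eq_sym => /negbTE ->; rewrite mulr0n rmorph0 mul0r.
- move=> r s Rr Rs; split.
    apply: (rel_uniq (r - s)); first by apply: alphaP; exact: RB.
    move=> i; rewrite mulrBl mulrBr !alphaP // -sumrB; apply: eq_bigr => j _.
    by rewrite !mxE rmorphB mulrBl.
  apply/matrixP => i j; apply/eqP; rewrite -subr_eq0; apply/eqP.
  apply: (ind (fun j => (f *: alpha (r * s)) i j - (alpha r *m alpha s) i j)).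
  under eq_bigr => l _ do rewrite rmorphB mulrBl.
  rewrite sumrB; apply/eqP; rewrite subr_eq0; apply/eqP.
  (* Both matrices express [iota f ^+ 2 * r * s] times the basis vector of index [i], and
     coordinates are unique. *)
  transitivity (iota f * (iota f * (r * s * ws`_i))).
    rewrite (alphaP _ (RM _ _ Rr Rs)) mulr_sumr; apply: eq_bigr => l _.
    by rewrite mxE rmorphM mulrA.
  transitivity (\sum_l iota (alpha r i l) * (iota f * (s * ws`_l))).
    transitivity (iota f * s * (iota f * (r * ws`_i))); first by ring.
    rewrite (alphaP _ Rr) mulr_sumr; apply: eq_bigr => l _; ring.
  under eq_bigr => l _ do rewrite (alphaP _ Rs) mulr_sumr.
  rewrite exchange_big; apply: eq_bigr => l _ /=.
  rewrite mxE rmorph_sum mulr_suml; apply: eq_bigr => l' _.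
  by rewrite rmorphM mulrA.
- move=> r Rr r0.
  (* As 1 belongs to [ms], the nonzero [iota f] is in the span of [ws], so [ws] is not empty; its
     first element is nonzero by independence. *)
  have w0 : (0 < N)%N.
    rewrite lt0n; apply/eqP => N0; have [a] := aspan_coord (fP 1 ms1).
    rewrite mulr1 big1; last by case=> i /= ii; exfalso; move: ii; rewrite -/N N0.
    by rewrite -(rmorph0 iota) => /iota_inj/eqP; rewrite (negbTE f0).
  have wi0 : ws`_(Ordinal w0) != 0.
    apply/eqP => w_0.
    have : forall i : 'I_N, (i == Ordinal w0)%:R = 0 :> A.
      apply: ind; apply: big1 => i _.
      have [->|_] := eqVneq i (Ordinal w0); first by rewrite w_0 mulr0.
      by rewrite rmorph0 mul0r.
    by move=> /(_ (Ordinal w0))/eqP; rewrite eqxx oner_eq0.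
  have := alphaP r Rr (Ordinal w0); rewrite r0.
  rewrite big1 => [/eqP|j _]; last by rewrite mxE rmorph0 mul0r.
  rewrite !mulf_eq0 (negbTE wi0) orbF -(rmorph0 iota) (inj_eq iota_inj) (negbTE f0).
  by move/eqP.
Qed.
End Span.

(** * Matrices over the ring of integral elements as block matrices *)

Section Blowup.
Variables (A : idomainType) (K : fieldType) (N n : nat) (f : A) (R : K -> Prop).
Variable alpha : K -> 'M[A]_N.

Definition blowup_dim := #|{: 'I_n * 'I_N}|.

Definition blowup (X : 'M[K]_n) : 'M[A]_blowup_dim :=
  \matrix_(i, j) alpha (X (enum_val i).1 (enum_val j).1) (enum_val i).2 (enum_val j).2.

Definition entries_in (X : 'M[K]_n) := forall i j, R (X i j).

Hypothesis R1 : R 1.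
Hypothesis RB : forall r s, R r -> R s -> R (r - s).
Hypothesis RM : forall r s, R r -> R s -> R (r * s).
Hypothesis alpha1 : alpha 1 = f%:M.
Hypothesis alphaBM : forall r s, R r -> R s ->
  alpha (r - s) = alpha r - alpha s /\ f *: alpha (r * s) = alpha r *m alpha s.
Hypothesis alpha_inj : forall r, R r -> alpha r = 0 -> r = 0.

Lemma ring0 : R 0. Proof. by rewrite -(subrr 1); exact: RB. Qed.

Lemma ringD r s : R r -> R s -> R (r + s).
Proof.
by move=> Rr Rs; rewrite -[s]opprK -[- s]add0r; do ?apply: RB => //; exact: ring0.
Qed.

Lemma ring_sum (I : Type) (r : seq I) (F : I -> K) :
  (forall i, R (F i)) -> R (\sum_(i <- r) F i).
Proof. by move=> FR; apply: big_ind => //; [exact: ring0|exact: ringD]. Qed.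

Lemma entries_in1 : entries_in 1%:M.
Proof. by move=> i j; rewrite mxE; case: (i == j) => //; exact: ring0. Qed.

Lemma entries_inB X Y : entries_in X -> entries_in Y -> entries_in (X - Y).
Proof. by move=> RX RY i j; rewrite !mxE; exact: RB. Qed.

Lemma entries_inM X Y : entries_in X -> entries_in Y -> entries_in (X *m Y).
Proof. by move=> RX RY i j; rewrite mxE; apply: ring_sum => k; exact: RM. Qed.

Lemma alpha0 : alpha 0 = 0.
Proof. by rewrite -(subrr 1) (alphaBM R1 R1).1 subrr. Qed.

Lemma alphaD r s : R r -> R s -> alpha (r + s) = alpha r + alpha s.
Proof.
move=> Rr Rs; have Rn : R (0 - s) by apply: RB => //; exact: ring0.
have -> : r + s = r - (0 - s) by rewrite sub0r opprK.
by rewrite (alphaBM Rr Rn).1 (alphaBM ring0 Rs).1 alpha0 sub0r opprK.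
Qed.

Lemma alpha_sum (I : Type) (r : seq I) (F : I -> K) :
  (forall i, R (F i)) -> alpha (\sum_(i <- r) F i) = \sum_(i <- r) alpha (F i).
Proof.
move=> FR; elim: r => [|i r IH]; first by rewrite !big_nil alpha0.
by rewrite !big_cons alphaD ?IH //; exact: ring_sum.
Qed.

Lemma blowup1 : blowup 1%:M = f%:M.
Proof.
apply/matrixP => i j; rewrite !mxE -(inj_eq enum_val_inj).
case: (enum_val i) (enum_val j) => [i1 i2] [j1 j2] /=; rewrite xpair_eqE.
by case: (i1 == j1) => /=; rewrite ?alpha1 ?alpha0 mxE.
Qed.

Lemma blowupB X Y : entries_in X -> entries_in Y ->
  blowup (X - Y) = blowup X - blowup Y.
Proof. by move=> RX RY; apply/matrixP => i j; rewrite !mxE (alphaBM _ _).1 // !mxE. Qed.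

Lemma blowupM X Y : entries_in X -> entries_in Y ->
  f *: blowup (X *m Y) = blowup X *m blowup Y.
Proof.
move=> RX RY; apply/matrixP => i j; rewrite !mxE.
rewrite (reindex enum_rank) /=; last exact: onW_bij (enum_rank_bij _).
under [RHS]eq_bigr => l _ do rewrite !mxE !enum_rankK.
case: (enum_val i) (enum_val j) => [i1 i2] [j1 j2] /=.
rewrite -(pair_bigA _ (fun l1 l2 => alpha (X i1 l1) i2 l2 * alpha (Y l1 j1) l2 j2)) /=.
rewrite alpha_sum; last by move=> l; exact: RM.
rewrite summxE mulr_sumr; apply: eq_bigr => l _.
by have /matrixP/(_ i2 j2) := (alphaBM (RX i1 l) (RY l j1)).2; rewrite !mxE.
Qed.

Lemma blowup_inj X : entries_in X -> blowup X = 0 -> X = 0.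
Proof.
move=> RX /matrixP X0; apply/matrixP => i j; rewrite mxE; apply: alpha_inj => //.
apply/matrixP => k l; have := X0 (enum_rank (i, k)) (enum_rank (j, l)).
by rewrite !mxE !enum_rankK.
Qed.

End Blowup.

(* [alpha] is [f] times a representation over the fraction field of [A]. *)
Record scaled_rep (A : idomainType) (K : fieldType) (n M : nat) (f : A)
    (D : 'M[K]_n -> Prop) (alpha : 'M[K]_n -> 'M[A]_M) : Prop := ScaledRep {
  srep_f : f != 0;
  srep_D1 : D 1%:M;
  srep_DB : forall X Y, D X -> D Y -> D (X - Y);
  srep_DM : forall X Y, D X -> D Y -> D (X *m Y);
  srep_1 : alpha 1%:M = f%:M;
  srep_B : forall X Y, D X -> D Y -> alpha (X - Y) = alpha X - alpha Y;
  srep_M : forall X Y, D X -> D Y -> f *: alpha (X *m Y) = alpha X *m alpha Y;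
  srep_inj0 : forall X, D X -> alpha X = 0 -> X = 0 }.

(** Noether normalization makes all entries of [Xs] integral over [A]; the regular representation
    applies to a ring containing them, and replacing entries by blocks extends it to matrices. *)
Theorem exists_scaled_rep (K : fieldType) (p n : nat) (Xs : seq 'M[K]_n) :
    p \in [pchar K] ->
  exists (A : idomainType) (deg : A -> nat) (M : nat) (f : A)
    (D : 'M[K]_n -> Prop) (alpha : 'M[K]_n -> 'M[A]_M),
  [/\ Noether.degree_ring deg, p \in [pchar A], scaled_rep f D alpha
    & forall X, X \in Xs -> D X].
Proof.
move=> hp.
pose xs := [seq X ij.1 ij.2 | X : 'M[K]_n <- Xs, ij <- enum {: 'I_n * 'I_n}].
have [A [iota [deg [inj degA int]]]] := Noether.noether_degree xs hp.
have [N [f [R [alpha [f0 [Rxs R1 RB RM] alpha1 alphaBM alpha_inj]]]]] :=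
  regular_representation inj int.
exists A, deg, (blowup_dim N n), f, (entries_in R), (blowup alpha); split=> //.
- rewrite inE (pcharf_prime hp) /= -(inj_eq inj) rmorph0 rmorph_nat.
  by rewrite (pcharf0 hp).
- split=> //.
  + exact: entries_in1.
  + exact: entries_inB.
  + exact: entries_inM.
  + exact (blowup1 n R1 alpha1 alphaBM).
  + move=> X Y RX RY; exact (blowupB alphaBM RX RY).
  + move=> X Y RX RY; exact (blowupM R1 RB RM alphaBM RX RY).
  + move=> X RX; exact (blowup_inj alpha_inj RX).
- move=> X XXs i j; apply: Rxs; apply/allpairsP; exists (X, (i, j)).
  by rewrite mem_enum.
Qed.

(** * Scaled representations and the kernel of a specialization *)

Section ScaledRep.
Variables (A : idomainType) (K : fieldType) (n M : nat) (f : A).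
Variables (D : 'M[K]_n -> Prop) (alpha : 'M[K]_n -> 'M[A]_M).
Hypothesis rep : scaled_rep f D alpha.

Lemma srep_D0 : D 0.
Proof. by rewrite -(subrr 1%:M); apply: srep_DB (rep) _ _ _ _; exact: srep_D1 rep. Qed.

Lemma srep_DD X Y : D X -> D Y -> D (X + Y).
Proof.
move=> DX DY; rewrite -[Y]opprK -[- Y]add0r.
by do 2![apply: (srep_DB rep) => //]; exact: srep_D0.
Qed.

Lemma srep_0 : alpha 0 = 0.
Proof.
by rewrite -(subrr 1%:M) (srep_B rep) ?subrr //; exact: srep_D1 rep.
Qed.

Lemma srep_add X Y : D X -> D Y -> alpha (X + Y) = alpha X + alpha Y.
Proof.
move=> DX DY; have DN : D (0 - Y) by apply: (srep_DB rep) => //; exact: srep_D0.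
have -> : X + Y = X - (0 - Y) by rewrite sub0r opprK.
by rewrite !(srep_B rep) // ?srep_0 ?sub0r ?opprK //; exact: srep_D0.
Qed.

Lemma srep_inj X Y : D X -> D Y -> alpha X = alpha Y -> X = Y.
Proof.
move=> DX DY XY; apply/eqP; rewrite -subr_eq0; apply/eqP.
by apply: (srep_inj0 rep); rewrite ?(srep_B rep) ?XY ?subrr //; exact: srep_DB rep _ _ _ _.
Qed.

Lemma srep_DX X i : D X -> D (X ^+ i).
Proof.
move=> DX; elim: i => [|i IH]; first exact: srep_D1 rep.
by rewrite exprS; exact: (srep_DM rep).
Qed.

(* In the kernel of a specialization, the factor [\sum_(i < b) X ^+ i] of
   [X ^+ b - 1] specializes to the invertible scalar [b]. *)
Lemma specialization_kernel (k : fieldType) (s : {rmorphism A -> k}) (p b : nat)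
    (X : 'M[K]_n) : p \in [pchar A] -> s f != 0 -> D X ->
  map_mx s (alpha X) = (s f)%:M -> X ^+ b = 1 -> ~~ (p %| b)%N -> X = 1.
Proof.
move=> hp sf DX kerX Xb pb.
have sp : p \in [pchar k] by exact: rmorph_pchar hp.
have DXi i : D (X ^+ i) by exact: srep_DX.
pose Z := \sum_(i < b) X ^+ i.
have DS (r : seq 'I_b) : D (\sum_(i <- r) X ^+ i).
  by apply: big_ind => //; [exact: srep_D0|exact: srep_DD].
have alphaS (r : seq 'I_b) : alpha (\sum_(i <- r) X ^+ i) = \sum_(i <- r) alpha (X ^+ i).
  elim: r => [|i r IH]; first by rewrite !big_nil srep_0.
  by rewrite !big_cons srep_add // IH.
have DX1 : D (X - 1) by apply: (srep_DB rep) => //; exact: srep_D1 rep.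
have prod0 : alpha (X - 1) *m alpha Z = 0.
  rewrite -(srep_M rep) //; last exact: DS.
  have -> : (X - 1) *m Z = 0 by rewrite -[_ *m _]subrX1 Xb subrr.
  by rewrite srep_0 scaler0.
have sXi i : map_mx s (alpha (X ^+ i)) = (s f)%:M.
  elim: i => [|i IH]; first by rewrite expr0 (srep_1 rep) map_scalar_mx.
  have := congr1 (map_mx s) (srep_M rep DX (DXi i)).
  rewrite map_mxZ map_mxM kerX IH -scalar_mxM => E.
  by apply: (scalerI sf); rewrite exprS [LHS]E -scale_scalar_mx.
have sZ : map_mx s (alpha Z) = (b%:R * s f)%:M.
  rewrite alphaS raddf_sum /=; under eq_bigr => i _ do rewrite sXi.
  by rewrite sumr_const card_ord mulr_natl raddfMn.
have detZ : \det (alpha Z) != 0.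
  apply: contra_neq (_ : \det (map_mx s (alpha Z)) != 0).
    by rewrite det_map_mx => ->; rewrite rmorph0.
  rewrite sZ det_scalar expf_neq0 // mulf_neq0 //.
  by rewrite -(dvdn_pcharf sp).
have X10 : X - 1 = 0.
  apply: (srep_inj0 rep) => //.
  (* Over the domain [A], the adjugate stands in for an inverse of [alpha Z]. *)
  have : alpha (X - 1) *m alpha Z *m \adj (alpha Z) = 0 by rewrite prod0 mul0mx.
  rewrite -mulmxA mul_mx_adj mul_mx_scalar => /matrixP E.
  apply/matrixP => i j; have /eqP := E i j; rewrite !mxE mulf_eq0 (negbTE detZ).
  by move/eqP.
by apply/eqP; rewrite -subr_eq0 X10.
Qed.

End ScaledRep.

(** * Finite p-groups of matrices *)

Section UnipotentGroup.
Variables (L : fieldType) (p : nat).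
Hypothesis hp : p \in [pchar L].

(** Inverses are powers, since each element has finite order; so unit and products make the list [S]
    a group. *)
Record finite_pgroup n (S : seq 'M[L]_n) : Prop := FinitePgroup {
  fpg1 : 1%:M \in S;
  fpgM : {in S &, forall x y, x *m y \in S};
  fpg_exp : {in S, forall x : 'M[L]_n, exists a, x ^+ (p ^ a) = 1} }.

Lemma fpg_unit n (S : seq 'M[L]_n) x : finite_pgroup S -> x \in S -> x \in unitmx.
Proof.
move=> SP /(fpg_exp SP)[a xa].
have pa : (0 < p ^ a)%N by rewrite expn_gt0 (prime_gt0 (pcharf_prime hp)).
move: xa; rewrite -(prednK pa) exprS => /mulmx1_unit[]; by [].
Qed.

(** A linear representation of a [p]-group in characteristic [p] has a nonzero fixed vector. To
    apply this, [S] is realized as a permutation group on itself, a [p]-group by Cauchy's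
    theorem. *)
Lemma fixed_vector n (S : seq 'M[L]_n) : (0 < n)%N -> finite_pgroup S ->
  exists v : 'rV[L]_n, v != 0 /\ {in S, forall x, v *m x = v}.
Proof.
move=> n0 SP; pose T := seq_sub S; pose one : T := SeqSub (fpg1 SP).
(* The right multiplications: such a permutation is determined by the matrix to which it sends 1,
   and [r] below recovers that matrix. *)
pose Gs := [set s : {perm T} | [forall y, val (s y) == val y *m val (s one)]].
have GsP (s : {perm T}) : reflect (forall y, val (s y) = val y *m val (s one)) (s \in Gs).
  by rewrite inE; apply: (iffP forallP) => sP y; apply/eqP; rewrite sP.
have gG : group_set Gs.
  apply/group_setP; split=> [|s t /GsP sP /GsP tP].
    by apply/GsP => y; rewrite !perm1 mulmx1.
  by apply/GsP => y; rewrite !permM tP sP [in RHS]tP mulmxA.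
pose G := group gG.
pose r (s : {perm T}) := val (s one).
have rP : mx_repr G r.
  split=> [|s t /GsP sP /GsP tP]; first by rewrite /r perm1.
  by rewrite /r permM tP.
pose rG := MxRepresentation rP.
have pG : (p.-group G)%g.
  apply/pgroupP => q qp /(Cauchy qp)[s sG sq].
  have [a sa] := fpg_exp SP (valP (s one)).
  have sX i y : val ((s ^+ i)%g y) = val y *m (r s ^+ i).
    elim: i y => [|i IH] y; first by rewrite expg0 perm1 expr0 mulmx1.
    by rewrite expgSr permM (GsP s sG) IH exprSr mulmxA.
  have : (s ^+ (p ^ a) == 1)%g.
    by apply/eqP/permP => y; apply: val_inj; rewrite sX perm1 /r sa mulmx1.
  rewrite -order_dvdn sq (Euclid_dvdX _ _ qp) => /andP[qp' _].
  by rewrite inE -(dvdn_prime2 qp (pcharf_prime hp)).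
have := rfix_pgroup_pchar hp rG n0 pG (subxx _).
set W := rfix_mx _ _ => W0.
exists (nz_row W); rewrite nz_row_eq0; split=> // x xS.
have xu := fpg_unit SP xS.
pose tx (y : T) : T := SeqSub (fpgM SP (valP y) xS).
have tx_inj : injective tx.
  move=> y z /(congr1 val) /= E; apply: val_inj.
  by rewrite -[LHS](mulmxK xu) E mulmxK.
have sG : perm tx_inj \in G.
  by apply/GsP => y; rewrite !permE /= mul1mx.
have /rfix_mxP/(_ _ sG) := nz_row_sub W.
by rewrite /= /r permE /= mul1mx.
Qed.

(** Induction on [n]: in a basis starting with a fixed vector the first row of every element is that
    of the identity, and the lower right blocks, acting on the quotient by this vector, again form a
    finite [p]-group. *)
Lemma unitriangularize n (S : seq 'M[L]_n) : finite_pgroup S ->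
  exists h k : 'M[L]_n, h *m k = 1%:M /\
    {in S, forall x, is_trig_mx (h *m x *m k) /\ forall i, (h *m x *m k) i i = 1}.
Proof.
elim: n S => [|n IH] S SP.
  by exists 1%:M, 1%:M; rewrite mulmx1; split=> // x _; split; [apply/is_trig_mxP => -[]|case].
have [v [v0 vS]] := fixed_vector (ltn0Sn n) SP.
pose e0 : 'rV[L]_(1 + n) := row_mx 1%:M 0.
have e0v : e0 *m col_mx v (0 : 'M[L]_(n, 1 + n)) = v.
  by rewrite mul_row_col mul1mx mul0mx addr0.
have rk1 (w : 'rV[L]_(1 + n)) : w != 0 -> \rank w = 1%N by rewrite rank_rV => ->.
have e0n : e0 != 0.
  by apply: contraNneq v0 => E; rewrite -e0v E mul0mx.
(* [h] is an invertible matrix with first row [v]. *)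
have [|h [hu hE]] := @complete_unitmx _ _ _ e0 (col_mx v (0 : 'M[L]_(n, 1 + n))).
  by rewrite e0v !rk1.
rewrite e0v in hE.
pose k := invmx h.
have hk : h *m k = 1%:M by exact: mulmxV.
have kh : k *m h = 1%:M by exact: mulVmx.
pose c x : 'M[L]_(1 + n) := h *m x *m k.
have cM x y : c (x *m y) = c x *m c y.
  by rewrite /c !mulmxA -(mulmxA (h *m x) k h) kh mulmx1.
have cE x : x \in S -> c x = block_mx 1%:M 0 (dlsubmx (c x)) (drsubmx (c x)).
  move=> xS; rewrite -{1}[c x]submxK.
  have E : e0 *m c x = e0.
    by rewrite /c !mulmxA -hE vS // hE -mulmxA hk mulmx1.
  move: E; rewrite -{1}[c x]submxK mul_row_block !mul1mx !mul0mx !addr0.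
  by case/eq_row_mx => -> ->.
pose S' := [seq drsubmx (c x) | x <- S].
have c1 : drsubmx (c 1%:M) = 1%:M by rewrite /c mulmx1 hk scalar_mx_block block_mxKdr.
have drM x y : x \in S -> y \in S -> drsubmx (c (x *m y)) = drsubmx (c x) *m drsubmx (c y).
  by move=> xS yS; rewrite cM (cE x xS) (cE y yS) mulmx_block !block_mxKdr mulmx0 add0r.
have S'P : finite_pgroup S'.
  split.
  - by apply/mapP; exists 1%:M; first exact: fpg1.
  - move=> _ _ /mapP[x xS ->] /mapP[y yS ->]; apply/mapP; exists (x *m y).
      exact: fpgM.
    by rewrite drM.
  - move=> _ /mapP[x xS ->]; have [a xa] := fpg_exp SP xS; exists a.
    have drX i : x ^+ i \in S /\ drsubmx (c (x ^+ i)) = drsubmx (c x) ^+ i.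
      elim: i => [|i [xi IHi]]; first by split; [exact: fpg1|exact: c1].
      by rewrite !exprS -IHi; split; [exact: fpgM|exact: drM].
    by rewrite -(drX _).2 xa; exact: c1.
have [h' [k' [hk' tri]]] := IH S' S'P.
pose hb : 'M[L]_(1 + n) := block_mx 1%:M 0 0 h'.
pose kb : 'M[L]_(1 + n) := block_mx 1%:M 0 0 k'.
have hkb : hb *m kb = 1%:M.
  rewrite mulmx_block !(mul1mx, mulmx1, mul0mx, mulmx0, addr0, add0r) hk'.
  by rewrite -scalar_mx_block.
exists (hb *m h), (k *m kb); split.
  by rewrite !mulmxA -(mulmxA hb h k) hk mulmx1; exact: hkb.
move=> x xS.
have -> : hb *m h *m x *m (k *m kb) =
    block_mx 1%:M 0 (h' *m dlsubmx (c x)) (h' *m drsubmx (c x) *m k') :> 'M[L]_(1 + n).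
  transitivity (hb *m c x *m kb); first by rewrite /c !mulmxA.
  rewrite (cE x xS) !mulmx_block !(mul1mx, mulmx1, mul0mx, mulmx0, addr0, add0r).
  by rewrite block_mxKdl block_mxKdr.
have [tr diag] := tri _ (map_f (fun x => drsubmx (c x)) xS).
split.
  have T : is_trig_mx (block_mx 1%:M 0 (h' *m dlsubmx (c x)) (h' *m drsubmx (c x) *m k') : 'M[L]_(1 + n, 1 + n)).
    by rewrite is_trig_block_mx // eqxx tr mx11_is_trig.
  exact: T.
move=> i; case: (split_ordP (i : 'I_(1 + n))) => j ->.
  by rewrite [LHS]block_mxEul mxE eqxx.
by rewrite [LHS]block_mxEdr.
Qed.

End UnipotentGroup.

From mathcomp Require Import all_classical all_reals all_analysis.

Local Open Scope classical_set_scope.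
Local Open Scope ring_scope.

(** * Matrices over ultrametric fields *)

Record ultranorm (R : realFieldType) (L : fieldType) (nm : L -> R) : Prop := Ultranorm {
  nm_ge0 : forall x, 0 <= nm x;
  nm0 : nm 0 = 0;
  nm_eq0 : forall x, nm x = 0 -> x = 0;
  nmM : forall x y, nm (x * y) = nm x * nm y;
  nmD : forall x y, nm (x + y) <= Num.max (nm x) (nm y) }.

Section Ultrametric.
Variables (R : realFieldType) (L : fieldType) (nm : L -> R).
Hypothesis nmP : ultranorm nm.

Lemma nm_gt0 x : x != 0 -> 0 < nm x.
Proof.
move=> x0; rewrite lt_neqAle (nm_ge0 nmP) andbT eq_sym.
by apply: contra_neq x0; exact: nm_eq0.
Qed.

Lemma nm1 : nm 1 = 1.
Proof.
have n1 : nm 1 != 0 by rewrite gt_eqF // nm_gt0 // oner_neq0.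
by apply: (mulfI n1); rewrite -(nmM nmP) !mulr1.
Qed.

Lemma nmN x : nm (- x) = nm x.
Proof.
have /eqP : nm (-1) ^+ 2 = 1 by rewrite expr2 -(nmM nmP) mulrNN mulr1 nm1.
rewrite sqrf_eq1 => /orP[/eqP n1|/eqP n1].
  by rewrite -mulN1r (nmM nmP) n1 mul1r.
by have := nm_ge0 nmP (-1); rewrite n1 oppr_ge0 ler10.
Qed.

Lemma nmV x : nm x^-1 = (nm x)^-1.
Proof.
have [->|x0] := eqVneq x 0; first by rewrite invr0 (nm0 nmP) invr0.
have nx : nm x != 0 by rewrite gt_eqF // nm_gt0.
by apply: (mulfI nx); rewrite -(nmM nmP) !divff // nm1.
Qed.

Lemma nm_sum (I : Type) (r : seq I) (P : pred I) (F : I -> L) c : 0 <= c ->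
  (forall i, P i -> nm (F i) <= c) -> nm (\sum_(i <- r | P i) F i) <= c.
Proof.
move=> c0 Fc; apply: (big_ind (fun x => nm x <= c)) => //; first by rewrite (nm0 nmP).
by move=> x y xc yc; apply: le_trans (nmD nmP _ _) _; rewrite ge_max xc.
Qed.

Definition mxle m n c (A : 'M[L]_(m, n)) := forall i j, nm (A i j) <= c.

Lemma mxle_mul m n q c c' (A : 'M[L]_(m, n)) (B : 'M[L]_(n, q)) : 0 <= c -> 0 <= c' ->
  mxle c A -> mxle c' B -> mxle (c * c') (A *m B).
Proof.
move=> c0 c'0 Ac Bc i j; rewrite mxE; apply: nm_sum => [|k _]; first exact: mulr_ge0.
by rewrite (nmM nmP) ler_pM ?(nm_ge0 nmP).
Qed.

Lemma mxle1 n : mxle 1 (1%:M : 'M[L]_n).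
Proof. by move=> i j; rewrite mxE; case: (i == j); rewrite /= ?nm1 ?(nm0 nmP). Qed.

Lemma mxle_block m1 m2 n1 n2 c (A : 'M[L]_(m1, n1)) (B : 'M[L]_(m1, n2)) (C : 'M[L]_(m2, n1))
    (D : 'M[L]_(m2, n2)) : mxle c A -> mxle c B -> mxle c C -> mxle c D ->
  mxle c (block_mx A B C D).
Proof.
move=> Ac Bc Cc Dc i j.
by case: (split_ordP i) => i' ->; case: (split_ordP j) => j' ->;
  rewrite ?(block_mxEul, block_mxEur, block_mxEdl, block_mxEdr).
Qed.

(** Column reduction with the entry of largest norm in the first row as pivot: the multipliers then
    have norm at most 1, so the transformation and its inverse are both integral, that is, have
    entries of norm at most 1. *)
Lemma iwasawa n (g : 'M[L]_n) : g \in unitmx -> exists k k' : 'M[L]_n,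
  [/\ k *m k' = 1%:M, mxle 1 k, mxle 1 k' & is_trig_mx (g *m k)].
Proof.
elim: n g => [|n IH] g gU.
  exists 1%:M, 1%:M; rewrite mulmx1; split=> //; [exact: mxle1|exact: mxle1|].
  by apply/is_trig_mxP => -[].
pose j0 := [arg max_(j > ord0) nm (g ord0 j)]%O.
have j0max j : nm (g ord0 j) <= nm (g ord0 j0).
  by rewrite /j0; case: arg_maxP => // i _; apply.
have gj0 : g ord0 j0 != 0.
  apply/eqP => g0; have row0 : row ord0 g = 0.
    apply/rowP => j; rewrite !mxE; apply: (nm_eq0 nmP); apply/eqP.
    by rewrite eq_le (nm_ge0 nmP) andbT -(nm0 nmP) -g0.
  have := mulmxV gU => /(congr1 (row ord0)); rewrite row_mul row0 mul0mx.
  by move=> /rowP/(_ ord0); rewrite !mxE eqxx => /esym/eqP; rewrite oner_eq0.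
pose k1 : 'M[L]_n.+1 := tperm_mx ord0 j0.
have k1K : k1 *m k1 = 1%:M by rewrite -perm_mxM tperm2 perm_mx1.
have k1O : mxle 1 k1.
  by move=> i j; rewrite !mxE; case: (_ == _); rewrite /= ?nm1 ?(nm0 nmP).
have [g1 g1D] : exists g1 : 'M[L]_(1 + n), g1 = g *m k1 by exists (g *m k1).
have g1E j : g1 ord0 j = g ord0 (tperm ord0 j0 j).
  by rewrite g1D /k1 -xcolE mxE.
pose a := g1 ord0 ord0.
have aE : a = g ord0 j0 by rewrite /a g1E tpermL.
have a0 : a != 0 by rewrite aE.
pose u : 'rV_n := - a^-1 *: ursubmx g1.
have uO : mxle 1 u.
  move=> i j; rewrite ord1 !mxE (nmM nmP) nmN nmV mulrC ler_pdivrMr ?nm_gt0 // mul1r.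
  rewrite aE; have -> : lshift n (0 : 'I_1) = ord0 by exact: val_inj.
  by rewrite g1E.
pose k2 : 'M[L]_(1 + n) := block_mx 1%:M u 0 1%:M.
pose k2' : 'M[L]_(1 + n) := block_mx 1%:M (- u) 0 1%:M.
have z_le m q : mxle 1 (0 : 'M[L]_(m, q)) by move=> i j; rewrite mxE (nm0 nmP).
have k2K : k2 *m k2' = 1%:M.
  rewrite mulmx_block !(mul1mx, mulmx1, mul0mx, mulmx0, addr0, add0r) addNr.
  by rewrite -scalar_mx_block.
have ulE : ulsubmx g1 = a%:M.
  apply/matrixP => i j; rewrite !ord1 !mxE eqxx mulr1n /a.
  by congr (g1 _ _); apply: val_inj.
have g2E : g1 *m k2 = block_mx a%:M 0 (dlsubmx g1) (dlsubmx g1 *m u + drsubmx g1).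
  rewrite -{1}[g1]submxK ulE mulmx_block !(mulmx1, mulmx0, addr0).
  congr block_mx; rewrite mul_scalar_mx /u scalerA mulrN divff // scaleN1r addNr //.
set g' := _ + drsubmx g1 in g2E.
have g'U : g' \in unitmx.
  have : g1 *m k2 \in unitmx.
    rewrite unitmx_mul; apply/andP; split; last by case: (mulmx1_unit k2K).
    by rewrite g1D unitmx_mul gU; case: (mulmx1_unit k1K).
  by rewrite g2E !unitmxE det_lblock unitrM => /andP[].
have [k3 [k3' [k3K k3O k3'O trig]]] := IH g' g'U.
pose k4 : 'M[L]_(1 + n) := block_mx 1%:M 0 0 k3.
pose k4' : 'M[L]_(1 + n) := block_mx 1%:M 0 0 k3'.
exists (k1 *m k2 *m k4), (k4' *m k2' *m k1).
have O1 (A B : 'M[L]_n.+1) : mxle 1 A -> mxle 1 B -> mxle 1 (A *m B).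
  by move=> AO BO; rewrite -[1]mulr1; apply: mxle_mul.
have k2O : mxle 1 k2 by apply: mxle_block => //; exact: mxle1.
have k2'O : mxle 1 k2'.
  by apply: mxle_block => //; try exact: mxle1; move=> i j; rewrite mxE nmN.
have k4O : mxle 1 k4 by apply: mxle_block => //; exact: mxle1.
have k4'O : mxle 1 k4' by apply: mxle_block => //; exact: mxle1.
split.
- have k4K : k4 *m k4' = 1%:M.
    rewrite mulmx_block !(mul1mx, mulmx1, mul0mx, mulmx0, addr0, add0r) k3K.
    by rewrite -scalar_mx_block.
  rewrite !mulmxA -(mulmxA (k1 *m k2)) k4K mulmx1 -(mulmxA k1) k2K mulmx1.
  exact: k1K.
- by apply: (O1) => //; apply: O1.
- by apply: (O1) => //; apply: O1.
- have -> : g *m (k1 *m k2 *m k4) = (g1 *m k2 : 'M[L]_(1 + n)) *m k4.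
    by rewrite g1D !mulmxA.
  rewrite g2E mulmx_block !(mulmx1, mulmx0, mul0mx, addr0, add0r).
  have T : is_trig_mx (block_mx a%:M 0 (dlsubmx g1) (g' *m k3) : 'M[L]_(1 + n, 1 + n)).
    by rewrite is_trig_block_mx // eqxx trig mx11_is_trig.
  exact: T.
Qed.

Lemma trig_unit_diag n (A : 'M[L]_n) i : is_trig_mx A -> A \in unitmx -> A i i != 0.
Proof.
move=> trA; rewrite unitmxE det_trig // unitfE => /prodf_neq0; exact.
Qed.

Lemma trig_mulE n (A B : 'M[L]_n) i : is_trig_mx A -> is_trig_mx B ->
  (A *m B) i i = A i i * B i i.
Proof.
move=> /is_trig_mxP trA /is_trig_mxP trB; rewrite mxE (bigD1 i) //= big1 ?addr0 // => k ki.
case: (ltngtP i k) => [ik|ik|/val_inj ik]; first by rewrite trA ?mul0r.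
  by rewrite trB ?mulr0.
by rewrite ik eqxx in ki.
Qed.

Lemma trig_mul n (A B : 'M[L]_n) : is_trig_mx A -> is_trig_mx B -> is_trig_mx (A *m B).
Proof.
move=> /is_trig_mxP trA /is_trig_mxP trB; apply/is_trig_mxP => i j ij.
rewrite mxE big1 // => k _; have [ki|ik] := leqP k i.
  by rewrite trB ?mulr0 // (leq_ltn_trans ki).
by rewrite trA ?mul0r.
Qed.

(** Forward substitution along the rows of [X], dividing by the nonzero diagonal entries of [A]. *)
Lemma trig_solve n (A X B : 'M[L]_n) : is_trig_mx A -> A \in unitmx ->
  A *m X = B -> is_trig_mx B -> is_trig_mx X.
Proof.
move=> trA Au AX /is_trig_mxP trB; apply/is_trig_mxP => i.
have [m] := ubnP (val i); elim: m i => // m IH i im j ij.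
have := trB i j ij; rewrite -AX mxE (bigD1 i) //= big1 ?addr0.
  by move/eqP; rewrite mulf_eq0 (negbTE (trig_unit_diag i trA Au)) => /eqP.
move=> k ki; case: (ltngtP i k) => [ik|ik|/val_inj ik].
- by rewrite (is_trig_mxP trA) ?mul0r.
- by rewrite (IH k) ?mulr0 //; [exact: leq_trans ik _|exact: ltn_trans ik ij].
- by rewrite ik eqxx in ki.
Qed.

(* With [rho t j = |b_t(j,j)| / |b_0(j,j)|] and [E = e * delta ^+ 2], the partial
   products [P] satisfy [|P(i,j)| <= rho t j * E ^+ (i - j)]; the ultrametric
   inequality makes this bound independent of the number of steps. *)
Lemma chain_bound n m (b X : nat -> 'M[L]_n) (e delta : R) : 1 <= e -> 1 <= delta ->
    (forall t, (t <= m)%N -> is_trig_mx (b t) /\ b t \in unitmx) ->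
    (forall t, (t < m)%N -> b t *m X t = b t.+1 /\ mxle e (X t)) ->
    (forall t, (t <= m)%N -> forall i,
      nm (b t i i) <= delta * nm (b 0%N i i) /\ nm (b 0%N i i) <= delta * nm (b t i i)) ->
  exists P, b 0%N *m P = b m /\ mxle (delta * (e * delta ^+ 2) ^+ n) P.
Proof.
move=> e1 d1 trb bX bd; set E := e * delta ^+ 2.
have d0 : 0 < delta by exact: lt_le_trans d1.
have e0 : 0 < e by exact: lt_le_trans e1.
have E1 : 1 <= E by rewrite /E mulr_ege1 // exprn_ege1.
have E0 : 0 < E by exact: lt_le_trans E1.
pose rho t j := nm (b t j j) / nm (b 0%N j j).
have b0 j : 0 < nm (b 0%N j j).
  by have [] := trb 0%N (leq0n _) => tr u; rewrite nm_gt0 // trig_unit_diag.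
have rho_le t j : (t <= m)%N -> rho t j <= delta.
  by move=> tm; rewrite /rho ler_pdivrMr //; exact: (bd t tm j).1.
have rho_ge t j : (t <= m)%N -> 1 <= delta * rho t j.
  by move=> tm; rewrite /rho mulrA ler_pdivlMr // mul1r; exact: (bd t tm j).2.
have rho0 t j : (t <= m)%N -> 0 <= rho t j.
  by move=> tm; rewrite /rho divr_ge0 ?(nm_ge0 nmP).
have key t : (t <= m)%N -> exists P, [/\ b 0%N *m P = b t, is_trig_mx P &
    forall i j : 'I_n, (j <= i)%N -> nm (P i j) <= rho t j * E ^+ (i - j)].
  elim: t => [|t IH] tm.
    exists 1%:M; rewrite mulmx1; split=> //.
    move=> i j ji; rewrite /rho divff ?gt_eqF // mul1r.
    by apply: le_trans (mxle1 i j) _; rewrite exprn_ege1.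
  have [P [bP trP Ple]] := IH (ltnW tm); have [bXt Xe] := bX t tm.
  have [trbt ubt] := trb t (ltnW tm); have [trbt' _] := trb t.+1 tm.
  have trX : is_trig_mx (X t) by exact: trig_solve trbt ubt bXt trbt'.
  exists (P *m X t); rewrite mulmxA bP; split=> //; first exact: trig_mul.
  move=> i j ji; rewrite mxE.
  have bnd0 : 0 <= rho t.+1 j * E ^+ (i - j) by rewrite mulr_ge0 ?rho0 // exprn_ge0 // ltW.
  apply: nm_sum => // k _.
  have [kj|jk|jk] := ltngtP k j.
  - by rewrite (is_trig_mxP trX) // mulr0 (nm0 nmP).
  (* One extra factor [E = e * delta ^+ 2] pays for the step bound [e], for [rho t k <= delta] and
     for [1 <= delta * rho t.+1 j]; it is available because [i - k < i - j]. *)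
  - have [ki|ik] := leqP k i; last by rewrite (is_trig_mxP trP) // mul0r (nm0 nmP).
    rewrite (nmM nmP); apply: (@le_trans _ _ (rho t k * E ^+ (i - k) * e)).
      by rewrite ler_pM ?(nm_ge0 nmP) // Ple.
    apply: (@le_trans _ _ (delta * E ^+ (i - k) * e)).
      by rewrite ler_wpM2r ?(ltW e0) // ler_wpM2r ?exprn_ge0 ?(ltW E0) // rho_le // ltnW.
    apply: (@le_trans _ _ (rho t.+1 j * E ^+ (i - k).+1)); last first.
      rewrite ler_wpM2l ?rho0 // ler_weXn2l //; lia.
    have -> : rho t.+1 j * E ^+ (i - k).+1 =
        (delta * rho t.+1 j) * (delta * E ^+ (i - k) * e).
      by rewrite exprS /E; ring.
    by rewrite ler_peMl ?rho_ge // !mulr_ge0 ?(ltW d0) ?(ltW e0) // exprn_ge0 // ltW.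
  (* The diagonal term loses nothing, as [rho t j * nm (X t j j) = rho t.+1 j]; hence no growth with
     [t]. *)
  - move/val_inj: jk => ->; rewrite (nmM nmP).
    apply: (@le_trans _ _ (rho t j * E ^+ (i - j) * nm (X t j j))).
      by rewrite ler_wpM2r ?(nm_ge0 nmP) // Ple.
    by rewrite /rho -bXt trig_mulE // (nmM nmP) le_eqVlt; apply/orP; left; apply/eqP; ring.
have [P [bP trP Ple]] := key m (leqnn m); exists P; split=> // i j.
have [ji|ij] := leqP j i; last first.
  by rewrite (is_trig_mxP trP) // (nm0 nmP) mulr_ge0 ?(ltW d0) // exprn_ge0 // ltW.
apply: le_trans (Ple i j ji) _; apply: ler_pM; rewrite ?rho0 ?exprn_ge0 ?(ltW E0) ?rho_le //.
by rewrite ler_weXn2l //; have := ltn_ord i; lia.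
Qed.

End Ultrametric.

(** * A criterion for uniform asymptotic dimension *)

Section Criterion.
Variables (R : realType) (G : groupType) (d : left_invariant_metric R G).

Lemma to_quotientM (F : finite_subgroup G) f g :
  f \in F -> to_quotient d F (f * g)%g = to_quotient d F g.
Proof.
move=> Ff; apply: quotient_dist_positivity; apply/eqP.
rewrite eq_le quotient_dist_ge0 andbT.
have [_ /(_ f Ff)] := quotient_dist_min d F (f * g)%g g.
by rewrite lmdistxx.
Qed.

(** The two floors differ by at most 1, so equal parity makes them equal; the absolute value only
    serves to read off the parity of an integer. *)
Lemma parity_floor (x y : R) : `|x - y| < 1 ->
  odd `|Num.floor x|%N = odd `|Num.floor y|%N -> Num.floor x = Num.floor y.
Proof.
move=> xy par.
have dist (u v : R) : `|u - v| < 1 -> (Num.floor u <= Num.floor v + 1)%R.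
  move=> uv; rewrite -ltzD1 -(ltr_int R).
  apply: (le_lt_trans (ge_floor u)); rewrite !intrD.
  have := lt_succ_floor v; rewrite intrD => vl.
  have := ler_norm (u - v); lra.
have := dist _ _ xy; have := dist y x; rewrite distrC => /(_ xy).
move: (Num.floor x) (Num.floor y) par => a b; lia.
Qed.

Variables (T : finType) (Psi : finite_subgroup G -> G -> T -> R).
Hypothesis Psi_inv : forall (F : finite_subgroup G) f g t, f \in F -> Psi F (f * g)%g t = Psi F g t.
Hypothesis Psi_lip : forall F g h t, `|Psi F g t - Psi F h t| <= d g h.
(** Only chains are controlled: the preimage of a bounded set of coordinates may itself be
    unbounded. The constant [B] is chosen before [F], which gives the uniformity. *)
Hypothesis Psi_chain : forall r s : R, exists B : R, forall (F : finite_subgroup G) m (g : nat -> G),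
  (forall t, (t < m)%N -> d (g t) (g t.+1) <= r) ->
  (forall t, (t <= m)%N -> forall c, `|Psi F (g t) c - Psi F (g 0%N) c| <= s) ->
  d (g 0%N) (g m) <= B.

Section Pieces.
Variables (F : finite_subgroup G) (r : R).
Hypothesis r0 : 0 < r.
Local Notation Q := (quotient_space d F).

Definition cell (X : Q) c : int := Num.floor (Psi F (quotient_repr X) c / (r + 2)).

Lemma cell_to_quotient g c :
  cell (to_quotient d F g) c = Num.floor (Psi F g c / (r + 2)).
Proof. by rewrite /cell; have [f Ff ->] := repr_to_quotient d F g; rewrite Psi_inv. Qed.

Definition color_class (k : {ffun T -> bool}) : set Q :=
  [set X | forall c, odd `|cell X c|%N = k c].

Definition step k (X Y : Q) :=
  [/\ color_class k X, color_class k Y & mdist X Y <= r + 1].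

Definition component k (X : Q) : set Q := [set Y | clos_refl_trans _ (step k) X Y].

Lemma component_eq k X Y : step k X Y -> component k X = component k Y.
Proof.
move=> st; have st' : step k Y X by case: st => ? ? le; split=> //; rewrite metric_sym.
by apply/seteqP; split=> Z /= XZ; apply: rt_trans XZ; apply: rt_step.
Qed.

(* Within one color class a step of length at most [r + 1] cannot reach a
   different cell of the same parity, as cells have side [r + 2]. *)
Lemma component_lift k X Y g0 : to_quotient d F g0 = X -> component k X Y ->
  exists m (g : nat -> G), [/\ g 0%N = g0, to_quotient d F (g m) = Y,
    forall t, (t < m)%N -> d (g t) (g t.+1) <= r + 1
  & forall t, (t <= m)%N -> forall c,
      Num.floor (Psi F (g t) c / (r + 2)) = Num.floor (Psi F g0 c / (r + 2))].
Proof.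
move=> gX XY; apply clos_rt_rtn1 in XY.
induction XY as [|Y Z [UY UZ YZ] _ [m [g [g00 gY gs gc]]]].
  by exists 0%N, (fun=> g0); split=> // t; rewrite leqn0 => /eqP->.
(* The coset [Z] has a representative [h] at which its distance to the coset of [g m] is attained,
   so the chain lifts step by step. *)
have [[f Ff dE] _] := quotient_dist_min d F (g m) (quotient_repr Z).
pose h := (f * quotient_repr Z)%g.
have hZ : to_quotient d F h = Z by rewrite to_quotientM // quotient_reprK.
have dh : d (g m) h <= r + 1.
  by rewrite -dE gY quotient_reprK.
exists m.+1, (fun t => if (t <= m)%N then g t else h); split=> //=.
- by rewrite ltnn.
- move=> t; rewrite ltnS => tm; rewrite tm; case: ltnP => [/gs//|mt].
  by have -> : t = m by apply/eqP; rewrite eqn_leq tm mt.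
- move=> t tm c; case: leqP => [/gc//|mt].
  rewrite -(gc m (leqnn _) c); apply/esym/parity_floor.
    have r2 : 0 < r + 2 by rewrite addr_gt0.
    rewrite -mulrBl normrM [X in _ * X]gtr0_norm ?invr_gt0 // ltr_pdivrMr // mul1r.
    by apply: le_lt_trans (Psi_lip _ _ _ _) _; apply: le_lt_trans dh _; rewrite ltrD2l ltr1n.
  by have := UY c; have := UZ c; rewrite -gY -hZ !cell_to_quotient => -> ->.
Qed.

End Pieces.

Theorem asdim_criterion :
  uniformly_finite_asdim (fun F : finite_subgroup G => quotient_space d F).
Proof.
(* One color for each parity pattern; [m] is the number of colors minus one. *)
exists #|{ffun T -> bool}|.-1 => r r0.
have cardE : #|{ffun T -> bool}|.-1.+1 = #|{ffun T -> bool}|.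
  by rewrite prednK //; apply/card_gt0P; exists [ffun=> true].
pose col (k : 'I_#|{ffun T -> bool}|.-1.+1) := enum_val (cast_ord cardE k).
(* The pieces are indexed by all subsets [C] of the quotient, and the piece of [C] is empty unless
   [C] is a component; distinct indices then mean distinct components. *)
exists (fun F k => @color_class F r (col k)),
  (fun F k => set (quotient_space d F)),
  (fun F k C => [set Y | @color_class F r (col k) Y /\ component r (col k) Y = C]).
split=> [F|F k|F k C C' CC'|].
- apply/seteqP; split=> // X _.
  exists (cast_ord (esym cardE) (enum_rank [ffun c => odd `|cell r X c|%N])) => //.
  by move=> c; rewrite /col cast_ordKV enum_rankK ffunE.
- apply/seteqP; split=> [Y UY|Y [C _ []//]].
  by exists (component r (col k) Y).
(* Components use steps up to [r + 1], so the infimum of the distances is at least [r + 1] and thus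
   strictly above [r]. *)
- apply: (@lt_le_trans _ _ (r + 1)%:E); first by rewrite lte_fin ltrDl.
  apply: le_ereal_inf_tmp => _ /= [X [UX XC] [Y [UY YC] <-]].
  rewrite lee_fin leNgt; apply/negP => lt; apply: CC'; rewrite -XC -YC.
  by apply: component_eq; split=> //; exact: ltW.
- have [B BP] := Psi_chain (r + 1) (r + 2).
  apply: (@le_lt_trans _ _ B%:E); last exact: ltry.
  apply: ge_ereal_sup => _ /= [F [k [C ->]]].
  apply: ge_ereal_sup => _ /= [X [UX XC] [Y [UY YC] <-]].
  rewrite lee_fin.
  have XY : component r (col k) X Y by rewrite XC -YC; exact: rt_refl.
  have [m [g [g0 gY gs gc]]] := component_lift r0 (quotient_reprK X) XY.
  apply: (@le_trans _ _ (d (g 0%N) (g m))).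
    rewrite -(quotient_reprK X) -gY -g0 mdist_quotientE.
    have [_ /(_ 1%g gpred1)] := quotient_dist_min d F (g 0%N) (g m).
    by rewrite mul1g.
  apply: (BP F _ _ gs) => t tm c; rewrite g0.
  have r2 : 0 < r + 2 by rewrite addr_gt0.
  have fl (x : R) : x = (r + 2) * (x / (r + 2)) by rewrite mulrC divfK // gt_eqF.
  rewrite (fl (Psi F (g t) c)) (fl (Psi F (quotient_repr X) c)) -mulrBr.
  rewrite normrM gtr0_norm // -[leRHS]mulr1 ler_pM2l //.
  have E := gc t tm c; move: (ge_floor (Psi F (g t) c / (r + 2)))
    (lt_succ_floor (Psi F (g t) c / (r + 2)))
    (ge_floor (Psi F (quotient_repr X) c / (r + 2)))
    (lt_succ_floor (Psi F (quotient_repr X) c / (r + 2))).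
  rewrite E !intrD ler_norml; lra.
Qed.

End Criterion.

(** * Metrics on linear groups *)

(** At least [k + 1] of the values [g i] are at most the [k]-th sorted one [a], so at least [k + 1]
    of the values [f i] are at most [a + c]. *)
Lemma sorted_nth_lip (R : realFieldType) (I : Type) (e : seq I) (f g : I -> R) (c : R) k :
  (forall i, f i <= g i + c) -> (k < size e)%N ->
  nth 0 (sort <=%R [seq f i | i <- e]) k <= nth 0 (sort <=%R [seq g i | i <- e]) k + c.
Proof.
move=> fg ke; set a := nth 0 (sort _ [seq g i | i <- e]) k.
apply: nth_count_le; first exact: sort_le_sorted.
rewrite count_sort count_map; apply: (@leq_trans (count (<= a) [seq g i | i <- e])); last first.
  rewrite count_map; apply: sub_count => i /= gi.
  by apply: le_trans (fg i) _; rewrite lerD2r.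
rewrite -(count_sort <=%R) ltnNge; apply/negP => le.
have := @nth_count_gt _ _ a 0 (sort <=%R [seq g i | i <- e]) k (sort_le_sorted _).
by rewrite le size_sort size_map ke ltxx => /(_ isT).
Qed.

(* A sequence with steps at most [r] climbing by more than [c (s + r)] has
   [c + 1] terms at pairwise distance more than [s], but an interval of length
   [s] contains at most one of them. *)
Lemma drift_up (R : realFieldType) (c m : nat) (x : nat -> R) (a : 'I_c -> R) (r s : R) :
    0 <= r -> 0 <= s ->
    (forall t, (t < m)%N -> x t.+1 <= x t + r) ->
    (forall t, (t <= m)%N -> exists j, a j <= x t <= a j + s) ->
  x m - x 0%N <= c%:R * (s + r).
Proof.
move=> r0 s0 step cov; rewrite leNgt; apply/negP => lt.
have c0 : (0 < c)%N by have [j _] := cov 0%N isT; case: c a lt cov j => // a _ _ [].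
have c0R : 0 < c%:R :> R by rewrite ltr0n.
pose eta := (x m - x 0%N) / c%:R.
have etaP : s + r < eta by rewrite /eta ltr_pdivlMr // mulrC.
(* A discrete intermediate value theorem: when [x] first reaches [tau], it overshoots by at most
   [r]. *)
have reach t : (t <= m)%N -> forall tau, x 0%N <= tau <= x t ->
    exists t', (t' <= t)%N /\ tau <= x t' <= tau + r.
  elim: t => [|t IH] tm tau /andP[t0 tt].
    by exists 0%N; rewrite leqnn; split=> //; apply/andP; split=> //; lra.
  have [le|gt] := leP tau (x t).
    have [|t' [t't H]] := IH (ltnW tm) tau; first by rewrite t0.
    by exists t'; rewrite leqW.
  by exists t.+1; rewrite leqnn tt; split=> //=; have := step t tm; lra.
have pick (j : 'I_c.+1) : exists t, (t <= m)%N /\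
    x 0%N + j%:R * eta <= x t <= x 0%N + j%:R * eta + r.
  apply: reach => //; have eta0 : 0 <= eta by lra.
  rewrite lerDl mulr_ge0 ?ler0n //=.
  have : j%:R * eta <= c%:R * eta by rewrite ler_wpM2r // ler_nat -ltnS.
  have -> : c%:R * eta = x m - x 0%N by rewrite /eta mulrC divfK // gt_eqF.
  lra.
have [tj tjP] := choice pick.
have cov' (j : 'I_c.+1) : exists i, a i <= x (tj j) <= a i + s.
  by apply: cov; exact: (tjP j).1.
have [f fP] := choice cov'.
have f_lt (j k : 'I_c.+1) : (j < k)%N -> f j <> f k.
  move=> jk fjk; have := fP j; have := fP k; rewrite fjk.
  have /andP[_ xj] := (tjP j).2; have /andP[xk _] := (tjP k).2.
  have : j%:R * eta + eta <= k%:R * eta.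
    rewrite -{2}[eta]mul1r -mulrDl ler_wpM2r; [by []|lra|].
    by rewrite natr1 ler_nat.
  move=> H /andP[k1 k2] /andP[j1 j2]; lra.
have /leq_card : injective f.
  move=> j k fjk; apply: val_inj; case: (ltngtP j k) => // [/f_lt|/f_lt]; by rewrite fjk.
by rewrite !card_ord ltnn.
Qed.

Lemma drift (R : realFieldType) (c m : nat) (x : nat -> R) (a : 'I_c -> R) (r s : R) :
    0 <= r -> 0 <= s ->
    (forall t, (t < m)%N -> `|x t.+1 - x t| <= r) ->
    (forall t, (t <= m)%N -> exists j, a j <= x t <= a j + s) ->
  `|x m - x 0%N| <= c%:R * (s + r).
Proof.
move=> r0 s0 step cov; rewrite ler_norml; apply/andP; split.
  have -> : x m - x 0%N = - (- x m - (- x 0%N)) by rewrite opprB opprK addrC.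
  rewrite lerN2; apply: (@drift_up _ c m (fun t => - x t) (fun j => - a j - s) r s) => //.
    by move=> t /step; rewrite ler_norml => /andP[+ _]; lra.
  by move=> t /cov[j /andP[j1 j2]]; exists j; apply/andP; split; lra.
apply: (@drift_up _ c m x a r s) => // t /step; rewrite ler_norml => /andP[_]; lra.
Qed.

(** * The length function and the metric of an ultrametric representation *)

Section MatrixNorm.
Variables (R : realFieldType) (L : fieldType) (nm : L -> R).
Hypothesis nmP : ultranorm nm.

Definition mxnorm m n (A : 'M[L]_(m, n)) : R :=
  \big[Num.max/0]_(ij : 'I_m * 'I_n) nm (A ij.1 ij.2).

Lemma mxle_norm m n (A : 'M[L]_(m, n)) : mxle nm (mxnorm A) A.
Proof. by move=> i j; apply: (le_bigmax _ (fun ij => nm (A ij.1 ij.2)) (i, j)). Qed.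

Lemma mxnorm_le m n (A : 'M[L]_(m, n)) c : 0 <= c -> mxle nm c A -> mxnorm A <= c.
Proof. by move=> c0 Ac; apply: bigmax_le => // -[i j] _; exact: Ac. Qed.

End MatrixNorm.

Section LinearGroup.
Variables (R : realType) (G : groupType) (L : fieldType) (nm : L -> R) (M : nat).
Variables (rho : G -> 'M[L]_M).
Hypothesis nmP : ultranorm nm.
Hypothesis rho1 : rho 1%g = 1%:M.
Hypothesis rhoM : forall g h, rho (g * h)%g = rho g *m rho h.

(** The entry 1 keeps the logarithm nonnegative even for [M = 0], where both norms are 0. *)
Definition gsize g : R := Num.max 1 (Num.max (mxnorm nm (rho g)) (mxnorm nm (rho g^-1%g))).

Lemma gsize_ge1 g : 1 <= gsize g. Proof. by rewrite le_max lexx. Qed.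

Lemma gsize_gt0 g : 0 < gsize g. Proof. exact: lt_le_trans (gsize_ge1 g). Qed.

Lemma mxle_gsize g : mxle nm (gsize g) (rho g).
Proof.
by move=> i j; apply: le_trans (mxle_norm nm (rho g) i j) _; rewrite !le_max lexx !orbT.
Qed.

Lemma gsizeV g : gsize g^-1%g = gsize g.
Proof. by rewrite /gsize invgK [Num.max (mxnorm _ _) _]maxC. Qed.

Lemma gsize_le c g : 1 <= c -> mxle nm c (rho g) -> mxle nm c (rho g^-1%g) -> gsize g <= c.
Proof.
move=> c1 gc gc'; have c0 : 0 <= c by exact: le_trans c1.
by rewrite !ge_max c1 !mxnorm_le.
Qed.

Lemma gsize1 : gsize 1%g = 1.
Proof.
apply/eqP; rewrite eq_le gsize_ge1 andbT.
by apply: gsize_le => //; rewrite ?invg1 rho1; exact: mxle1.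
Qed.

Lemma gsizeM g h : gsize (g * h)%g <= gsize g * gsize h.
Proof.
apply: gsize_le; first by rewrite mulr_ege1 ?gsize_ge1.
  by rewrite rhoM; apply: mxle_mul => //; rewrite ?(ltW (gsize_gt0 _)) //; exact: mxle_gsize.
rewrite invgM rhoM mulrC -(gsizeV g) -(gsizeV h).
by apply: mxle_mul => //; rewrite ?(ltW (gsize_gt0 _)) //; exact: mxle_gsize.
Qed.

Definition len g : R := ln (gsize g).

Lemma expR_len g : expR (len g) = gsize g.
Proof. by rewrite lnK // posrE gsize_gt0. Qed.

Lemma len_ge0 g : 0 <= len g. Proof. by rewrite ln_ge0 // gsize_ge1. Qed.
Lemma lenV g : len g^-1%g = len g. Proof. by rewrite /len gsizeV. Qed.
Lemma len1 : len 1%g = 0. Proof. by rewrite /len gsize1 ln1. Qed.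
Lemma lenM g h : len (g * h)%g <= len g + len h.
Proof.
by rewrite -ler_expR expRD !expR_len gsizeM.
Qed.

(* The second summand separates points that differ by an element of length 0. *)
Definition gdist g h : R := len (g^-1 * h)%g + (g != h)%:R.

Fact gdistxx g : gdist g g = 0.
Proof. by rewrite /gdist mulVg len1 eqxx addr0. Qed.

Fact gdist_positivity g h : gdist g h = 0 -> g = h.
Proof.
rewrite /gdist; case: eqVneq => //= _ /eqP.
by rewrite gt_eqF // ltr_wpDl // len_ge0.
Qed.

Fact gdist_sym g h : gdist g h = gdist h g.
Proof. by rewrite /gdist -lenV invgM invgK eq_sym. Qed.

Fact gdist_triangle h g k : gdist g k <= gdist g h + gdist h k.
Proof.
rewrite /gdist addrACA; apply: lerD.
  have -> : (g^-1 * k = (g^-1 * h) * (h^-1 * k))%g by rewrite mulgA mulgK.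
  exact: lenM.
have [->|gh] := eqVneq g h; first by rewrite add0r.
by apply: (@le_trans _ _ 1); rewrite ?lerDl ?ler0n // lern1 leq_b1.
Qed.

Fact gdist_linv g h h' : gdist (g * h)%g (g * h')%g = gdist h h'.
Proof. by rewrite /gdist invgM mulgA mulgKV (inj_eq (mulgI g)). Qed.

Definition glim : left_invariant_metric R G :=
  LeftInvariantMetric gdistxx gdist_positivity gdist_sym gdist_triangle gdist_linv.

Lemma len_le_glim g h : len (g^-1 * h)%g <= glim g h.
Proof. by rewrite /= lerDl ler0n. Qed.

Lemma glim_le_len g h : glim g h <= len (g^-1 * h)%g + 1.
Proof. by rewrite /= lerD2l lern1 leq_b1. Qed.

End LinearGroup.

Lemma finite_subgroup_order (G : groupType) (F : finite_subgroup G) (f : G) :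
  f \in F -> exists2 b, (0 < b)%N & (f ^+ b = 1)%g.
Proof.
move=> Ff; have /finite_seqP[s sF] := fsubgroup_finite F.
have Fs x : x \in F -> x \in s.
  by move=> Fx; have : [set` F] x by []; rewrite sF.
have FX i : (f ^+ i)%g \in F by exact: gpredXn.
pose idx (i : 'I_(size s).+1) : 'I_(size s) :=
  Ordinal (etrans (index_mem (f ^+ i)%g s) (Fs _ (FX i))).
have : ~ injective idx.
  by move=> /leq_card; rewrite !card_ord ltnn.
apply: contra_notP => /forall2NP noexp i j /(congr1 val) /= ij.
have {}ij : (f ^+ i = f ^+ j)%g.
  by rewrite -(nth_index 1%g (Fs _ (FX i))) ij nth_index // Fs.
have le (k l : nat) : (k < l)%N -> (f ^+ k)%g <> (f ^+ l)%g.
  move=> kl E; have [] := noexp (l - k)%N; first by rewrite subn_gt0.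
  by apply; apply: (mulgI (f ^+ k)%g); rewrite -expgnDr subnKC ?mulg1 // ltnW.
by apply: val_inj; case: (ltngtP i j) => // /le; rewrite ij.
Qed.

(** * Coordinates invariant under finite subgroups *)

Section Coordinates.
Variables (R : realType) (G : groupType) (L : fieldType) (nm : L -> R) (p M : nat).
(** [Gam] carries just an operation, as it will be the set of all square matrices over a finite
    field; [pi_ker] leaves only [p]-power torsion in the kernel of [pi]. *)
Variables (rho : G -> 'M[L]_M) (Gam : finType) (pi : G -> Gam) (gmul : Gam -> Gam -> Gam).
Hypothesis nmP : ultranorm nm.
Hypothesis hp : p \in [pchar L].
Hypothesis rho1 : rho 1%g = 1%:M.
Hypothesis rhoM : forall g h, rho (g * h)%g = rho g *m rho h.
Hypothesis piM : forall g h, pi (g * h)%g = gmul (pi g) (pi h).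
Hypothesis pi_ker : forall x b, pi x = pi 1%g -> ~~ (p %| b)%N -> (x ^+ b = 1)%g -> x = 1%g.

Local Notation len := (len nm rho).

Lemma rhoV g : rho g *m rho g^-1%g = 1%:M.
Proof. by rewrite -rhoM mulgV. Qed.

Lemma rhoX g i : rho (g ^+ i)%g = rho g ^+ i.
Proof.
by elim: i => [|i IH]; rewrite ?expg0 ?rho1 // expgS rhoM IH exprS.
Qed.

Lemma pi1M x y : pi x = pi 1%g -> pi (x * y)%g = pi y.
Proof. by move=> x1; rewrite piM x1 -piM mul1g. Qed.

(** If [f ^+ b = 1] and [b'] is the part of [b] prime to [p], then [f ^+ (p ^ logn p b)] is in the
    kernel and its [b']-th power is 1, so it is trivial. *)
Lemma kernel_pgroup (F : finite_subgroup G) : exists S : seq 'M[L]_M,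
  finite_pgroup p S /\ forall f, f \in F -> pi f = pi 1%g -> rho f \in S.
Proof.
have /finite_seqP[s sF] := fsubgroup_finite F.
have Fs x : (x \in F) = (x \in s).
  by apply/idP/idP => Fx; [have : [set` F] x by []|have : [set` s] x by []]; rewrite ?sF // -sF.
pose s0 := [seq f <- s | pi f == pi 1%g].
have s0P f : (f \in s0) = (pi f == pi 1%g) && (f \in F) by rewrite mem_filter Fs.
exists [seq rho f | f <- s0]; split; last first.
  by move=> f Ff f1; apply: map_f; rewrite s0P f1 eqxx.
split.
- by apply/mapP; exists 1%g; rewrite ?rho1 // s0P eqxx gpred1.
- move=> _ _ /mapP[f + ->] /mapP[g + ->]; rewrite !s0P => /andP[/eqP f1 Ff] /andP[/eqP g1 Fg].
  by rewrite -rhoM map_f // s0P pi1M // g1 eqxx gpredM.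
- move=> _ /mapP[f + ->]; rewrite s0P => /andP[/eqP f1 Ff].
  have [b b0 fb] := finite_subgroup_order Ff.
  exists (logn p b); rewrite -rhoX; transitivity (rho 1%g); [congr rho|exact: rho1].
  have fX i : pi (f ^+ i)%g = pi 1%g.
    by elim: i => [|i IH]; rewrite ?expg0 // expgS pi1M.
  have pp := pcharf_prime hp; have [b' pb' bE] := pfactor_coprime pp b0.
  apply: (@pi_ker _ b') => //; first by rewrite -prime_coprime.
  by rewrite -expgnA mulnC -bE.
Qed.

(* If [h] conjugates the p-group [F :&: ker pi] into the lower unitriangular
   matrices and [h * rho g = b * k] is an Iwasawa decomposition, then [phi g i]
   is the logarithm of the norm of [b i i]. *)
Lemma flag_coordinates (F : finite_subgroup G) : exists phi : G -> 'I_M -> R,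
  [/\ forall f g i, f \in F -> pi f = pi 1%g -> phi (f * g)%g i = phi g i,
      forall g1 g2 i, phi g2 i <= phi g1 i + len (g1^-1 * g2)%g
    & forall (m : nat) (g : nat -> G) (r D : R), 0 <= r -> 0 <= D ->
      (forall t, (t < m)%N -> len ((g t)^-1 * g t.+1)%g <= r) ->
      (forall t, (t <= m)%N -> forall i, `|phi (g t) i - phi (g 0%N) i| <= D) ->
      mxle nm (expR D * (expR r * expR D ^+ 2) ^+ M) (rho ((g 0%N)^-1 * g m)%g)].
Proof.
have [S [SP FS]] := kernel_pgroup F.
have [h [k [hk tri]]] := unitriangularize hp SP.
have kh : k *m h = 1%:M by exact: mulmx1C.
have hU g : h *m rho g \in unitmx.
  by rewrite unitmx_mul; apply/andP; split; [case: (mulmx1_unit hk)|case: (mulmx1_unit (rhoV g))].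
have iwa g : exists kk : 'M[L]_M * 'M[L]_M,
    [/\ kk.1 *m kk.2 = 1%:M, mxle nm 1 kk.1, mxle nm 1 kk.2 & is_trig_mx (h *m rho g *m kk.1)].
  by have [a [a' H]] := iwasawa nmP (hU g); exists (a, a').
have [K KP] := choice iwa.
pose b g := h *m rho g *m (K g).1.
have bU g : b g \in unitmx.
  by rewrite unitmx_mul hU; have [H _ _ _] := KP g; case: (mulmx1_unit H).
have K12 g : (K g).1 *m (K g).2 = 1%:M by have [] := KP g.
(* The transition factor from [b g1] to [b g2]. Its outer factors are integral, so the size of
   [g1^-1 * g2] bounds it. *)
pose X g1 g2 := (K g1).2 *m rho (g1^-1 * g2)%g *m (K g2).1.
have rhoVM g1 g2 : rho g1 *m rho (g1^-1 * g2)%g = rho g2 by rewrite -rhoM mulKVg.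
have bX g1 g2 : b g1 *m X g1 g2 = b g2.
  by rewrite /b /X !mulmxA -(mulmxA (h *m rho g1)) K12 mulmx1 -(mulmxA h) rhoVM.
have btri g : is_trig_mx (b g) by have [] := KP g.
have Xtri g1 g2 : is_trig_mx (X g1 g2) by exact: trig_solve (btri _) (bU _) (bX _ _) (btri _).
have X_le g1 g2 : mxle nm (expR (len (g1^-1 * g2)%g)) (X g1 g2).
  have [_ _ K2 _] := KP g1; have [_ K1 _ _] := KP g2.
  have s0 := ltW (gsize_gt0 nm rho (g1^-1 * g2)%g).
  rewrite expR_len (_ : gsize _ _ _ = 1 * gsize nm rho (g1^-1 * g2)%g * 1).
    apply: (mxle_mul nmP) => //; first by rewrite mul1r.
    by apply: (mxle_mul nmP) => //; exact: mxle_gsize.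
  by rewrite mul1r mulr1.
pose phi g i := ln (nm (b g i i)).
have bpos g i : 0 < nm (b g i i) by rewrite nm_gt0 // trig_unit_diag.
have expphi g i : expR (phi g i) = nm (b g i i) by rewrite lnK // posrE.
have lip g1 g2 i : phi g2 i <= phi g1 i + len (g1^-1 * g2)%g.
  rewrite -ler_expR expRD !expphi -(bX g1 g2) trig_mulE // (nmM nmP).
  by rewrite ler_wpM2l ?(nm_ge0 nmP) // X_le.
exists phi; split=> // [f g i Ff f1|m g r D r0 D0 steps near].
(* [u *m b g] has the diagonal of [b g]. It and [b (f * g)] are triangular parts of the same matrix,
   so integral triangular factors carry each to the other, and their diagonal norms agree. *)
- have [utri udiag] := tri _ (FS f Ff f1).
  pose u := h *m rho f *m k.
  have ub : u *m b g = h *m rho (f * g)%g *m (K g).1.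
    by rewrite /u /b rhoM !mulmxA -(mulmxA (h *m rho f)) kh mulmx1.
  have ubtri : is_trig_mx (u *m b g) by exact: trig_mul.
  have diagE : nm ((u *m b g) i i) = nm (b g i i).
    by rewrite trig_mulE // [u i i]udiag mul1r.
  have [Kf Kf1 Kf2 _] := KP (f * g)%g; have [Kg Kg1 Kg2 _] := KP g.
  have Y1 : b (f * g)%g *m ((K (f * g)%g).2 *m (K g).1) = u *m b g.
    by rewrite ub /b !mulmxA -(mulmxA (h *m _)) Kf mulmx1.
  have Y3 : u *m b g *m ((K g).2 *m (K (f * g)%g).1) = b (f * g)%g.
    by rewrite ub /b !mulmxA -(mulmxA (h *m _)) Kg mulmx1.
  have O1 (A B : 'M[L]_M) : mxle nm 1 A -> mxle nm 1 B -> mxle nm 1 (A *m B).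
    by move=> AO BO; rewrite -[1]mulr1; apply: mxle_mul.
  have ubU : u *m b g \in unitmx.
    rewrite ub unitmx_mul hU; by case: (mulmx1_unit Kg).
  have T1 := trig_solve (btri _) (bU _) Y1 ubtri.
  have T3 := trig_solve ubtri ubU Y3 (btri _).
  have dle (B B' Y : 'M[L]_M) : is_trig_mx B -> is_trig_mx Y -> mxle nm 1 Y ->
      B *m Y = B' -> nm (B' i i) <= nm (B i i).
    by move=> trB trY YO <-; rewrite trig_mulE // (nmM nmP) ler_piMr ?(nm_ge0 nmP) // YO.
  rewrite /phi; congr ln; apply/eqP; rewrite eq_le -diagE.
  by rewrite (dle _ _ _ ubtri T3 _ Y3) ?(dle _ _ _ (btri _) T1 _ Y1) //; exact: O1.
- have e1 (x : R) : 0 <= x -> 1 <= expR x by rewrite -expR0 ler_expR.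
  have [|||P [bP PE]] := @chain_bound _ _ _ nmP M m (fun t => b (g t))
    (fun t => X (g t) (g t.+1)) (expR r) (expR D) (e1 _ r0) (e1 _ D0).
  + by move=> t _; split.
  + move=> t tm; split; first exact: bX.
    by move=> i j; apply: le_trans (X_le _ _ _ _) _; rewrite ler_expR steps.
  + move=> t tm i; rewrite -!expphi -!expRD !ler_expR.
    by have := near t tm i; rewrite ler_norml => /andP[]; split; lra.
  have [_ K1 _ _] := KP (g 0%N); have [Km _ K2 _] := KP (g m).
  have -> : rho ((g 0%N)^-1 * g m)%g = (K (g 0%N)).1 *m P *m (K (g m)).2.
    have E : h *m rho (g 0%N) *m ((K (g 0%N)).1 *m P *m (K (g m)).2) = h *m rho (g m).
      by rewrite !mulmxA -/(b _) bP /b -mulmxA Km mulmx1.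
    apply: (can_inj (mulKmx (hU (g 0%N)))).
    by rewrite E -mulmxA rhoVM.
  set C := expR D * _ in PE *.
  have C0 : 0 <= C by rewrite mulr_ge0 ?exprn_ge0 ?mulr_ge0 ?exprn_ge0 ?expR_ge0.
  rewrite (_ : C = 1 * C * 1); last by rewrite mul1r mulr1.
  apply: (mxle_mul nmP) => //; first by rewrite mul1r.
  exact: (mxle_mul nmP).
Qed.

Hypothesis gmul_inj : forall f a b, gmul a (pi f) = gmul b (pi f) -> a = b.
Hypothesis rho_finite : forall C : R, finite_set [set g | mxle nm C (rho g)].

Local Notation d := (glim nmP rho1 rhoM).

Lemma glim_proper : proper_metric d.
Proof.
move=> x r; apply: (@sub_finite_set _ _ [set (x * g)%g | g in [set g | mxle nm (expR r) (rho g)]]).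
  move=> y /= xy; exists (x^-1 * y)%g; last by rewrite mulKVg.
  move=> i j; apply: (le_trans (@mxle_gsize _ _ _ nm _ rho (x^-1 * y)%g i j)).
  by rewrite -expR_len ler_expR (le_trans _ xy) // len_le_glim.
exact: finite_image.
Qed.

(* The functions [g |-> phi (f * g)], [f \in F], depend only on [pi f], so [F]
   permutes boundedly many of them: sorting their values gives [F]-invariant
   coordinates, and keeping these bounded confines [phi] to boundedly many
   intervals. *)
Theorem linear_asdim :
  uniformly_finite_asdim (fun F : finite_subgroup G => quotient_space d F).
Proof.
have [phi phiP] := choice flag_coordinates.
have /choice[sec secP] : forall Fa : finite_subgroup G * Gam, exists o : option G,
    if o is Some s then s \in Fa.1 /\ pi s = Fa.2 else forall f, f \in Fa.1 -> pi f <> Fa.2.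
  move=> [F a]; have [[f [Ff fa]]|no] := EM (exists f, f \in F /\ pi f = a).
    by exists (Some f).
  by exists None => f Ff fa; apply: no; exists f.
(* Indices outside the image of [F] get the constant 0. Right multiplication by [pi f] preserves
   this set of indices, and there are [#|Gam|] values for every [F]. *)
pose v F g i a := if sec (F, a) is Some s then phi F (s * g)%g i else 0.
pose st F g i := sort <=%R [seq v F g i a | a <- enum Gam].
pose Psi F g (ik : 'I_M * 'I_#|Gam|) := nth 0 (st F g ik.1) ik.2.
have phi_inv (F : finite_subgroup G) a b g i : a \in F -> b \in F -> pi a = pi b ->
    phi F (a * g)%g i = phi F (b * g)%g i.
  move=> Fa Fb ab; have [inv _ _] := phiP F.
  have -> : (a * g = (a * b^-1) * (b * g))%g by rewrite mulgA mulgVK.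
  by rewrite inv ?gpredM ?gpredV // piM ab -piM mulgV.
have phi_lip F g h i : `|phi F g i - phi F h i| <= len (g^-1 * h)%g.
  have [_ lip _] := phiP F; have := lip g h i; have := lip h g i.
  by rewrite -lenV invgM invgK ler_norml => ? ?; apply/andP; split; lra.
have v_lip F g h i a : `|v F g i a - v F h i a| <= len (g^-1 * h)%g.
  rewrite /v; case: (sec _) => [s|]; last by rewrite subrr normr0 len_ge0.
  by apply: le_trans (phi_lip _ _ _ _) _; rewrite invgM mulgA mulgVK.
have v_shift (F : finite_subgroup G) f g i a : f \in F ->
    v F (f * g)%g i a = v F g i (gmul a (pi f)).
  move=> Ff; rewrite /v; have := secP (F, a); have := secP (F, gmul a (pi f)).
  case: (sec (F, a)) => [s|]; case: (sec (F, _)) => [t|] //=.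
  - move=> [Ft tE] [Fs sE]; rewrite mulgA; apply: phi_inv; rewrite ?gpredM //.
    by rewrite piM sE tE.
  - by move=> /(_ (s * f)%g) + [Fs sE]; rewrite gpredM // piM sE => /(_ isT).
  - move=> [Ft tE] /(_ (t * f^-1)%g); rewrite gpredM ?gpredV // => /(_ isT) [].
    by apply: (gmul_inj (f := f)); rewrite -piM mulgVK.
have Psi_inv (F : finite_subgroup G) f g c : f \in F -> Psi F (f * g)%g c = Psi F g c.
  move=> Ff; congr nth; apply/perm_sort_leP.
  have -> : [seq v F (f * g)%g c.1 a | a <- enum Gam] =
      [seq v F g c.1 a | a <- [seq gmul a (pi f) | a <- enum Gam]].
    by rewrite -map_comp; apply: eq_map => a /=; rewrite v_shift.
  apply: perm_map; apply: uniq_perm; rewrite ?enum_uniq //.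
    by rewrite map_inj_uniq ?enum_uniq // => a b; exact: gmul_inj.
  have inj : injective (fun a => gmul a (pi f)) by move=> a b; exact: gmul_inj.
  move=> a; rewrite mem_enum; apply/mapP.
  by exists (invF inj a); [rewrite mem_enum | exact: esym (f_invF inj a)].
have Psi_len (F : finite_subgroup G) g h c : `|Psi F g c - Psi F h c| <= len (g^-1 * h)%g.
  have ck : (c.2 < size (enum Gam))%N by rewrite -cardE.
  rewrite /Psi /st ler_norml; apply/andP; split.
    rewrite lerNl opprB lerBlDl; apply: sorted_nth_lip => // a.
    have := v_lip F g h c.1 a; rewrite ler_norml => /andP[]; lra.
  rewrite lerBlDl; apply: sorted_nth_lip => // a.
  have := v_lip F g h c.1 a; rewrite ler_norml => /andP[]; lra.
apply: (@asdim_criterion _ _ _ _ Psi) => //.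
  by move=> F g h c; apply: le_trans (Psi_len _ _ _ _) (len_le_glim _ _ _ _ _).
move=> r s.
pose r1 := `|r|; pose s1 := `|s|.
have r10 : 0 <= r1 by exact: normr_ge0.
have s10 : 0 <= s1 by exact: normr_ge0.
(* [drift] with [#|Gam|] intervals of length [2 * s1] gives the bracket; the factor 2 allows the
   reversed chain to be compared with [g m] instead of [g 0]. *)
pose D : R := 2 * (#|Gam|%:R * (2 * s1 + r1)).
have D0 : 0 <= D by rewrite !mulr_ge0 ?ler0n // addr_ge0 // mulr_ge0.
pose C := expR D * (expR r1 * expR D ^+ 2) ^+ M.
(* The summand 1 accounts for the separating term of [gdist]. *)
exists (ln C + 1) => F m g steps near.
have stepl t : (t < m)%N -> len ((g t)^-1 * g t.+1)%g <= r1.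
  move=> tm; apply: le_trans (len_le_glim nmP rho1 rhoM _ _) _.
  by apply: le_trans (steps t tm) _; exact: ler_norm.
have phi_near t i : (t <= m)%N -> `|phi F (g t) i - phi F (g 0%N) i| <= #|Gam|%:R * (2 * s1 + r1).
  move=> tm; apply: (@drift _ _ t (fun t => phi F (g t) i)
    (fun k => Psi F (g 0%N) (i, k) - s1) r1 (2 * s1)) => //; first by rewrite mulr_ge0.
    move=> t' t't; rewrite distrC; apply: le_trans (phi_lip _ _ _ _) _.
    by apply: stepl; exact: leq_trans t't tm.
  move=> t' t't.
  (* [phi F (g t') i] is the value [v] at the index [pi 1], hence an entry of the sorted list; the
     near-constancy of that entry puts it into one of the fixed intervals. *)
  have [k kE] : exists k : 'I_#|Gam|, Psi F (g t') (i, k) = phi F (g t') i.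
    have : phi F (g t') i \in st F (g t') i.
      rewrite mem_sort; apply/mapP; exists (pi 1%g); first by rewrite mem_enum.
      rewrite /v; have := secP (F, pi 1%g).
      case: (sec _) => [e [/= Fe e1]|/= /(_ 1%g)]; last by rewrite gpred1 => /(_ isT).
      by rewrite -{1}[g t']mul1g; apply: phi_inv => //; exact: gpred1.
    move=> /(nthP 0)[k]; rewrite size_sort size_map -cardE => kG kE.
    by exists (Ordinal kG).
  exists k; have := near t' (leq_trans t't tm) (i, k); rewrite kE.
  move/le_trans => /(_ _ (ler_norm s)); rewrite ler_norml -/s1 => /andP[? ?].
  by apply/andP; split; lra.
have near1 t i : (t <= m)%N -> `|phi F (g t) i - phi F (g 0%N) i| <= D.
  move=> tm; apply: le_trans (phi_near t i tm) _.
  by rewrite /D ler_peMl ?ler1n // mulr_ge0 ?ler0n // addr_ge0 // mulr_ge0.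
have near2 t i : (t <= m)%N -> `|phi F (g (m - t)%N) i - phi F (g (m - 0)%N) i| <= D.
  move=> tm; have := phi_near _ i (leq_subr t m); have := phi_near _ i (leq_subr 0 m).
  rewrite /D !ler_norml => /andP[? ?] /andP[? ?]; apply/andP; split; lra.
have [_ _ bound] := phiP F.
have C1 : 1 <= C.
  have e1 (x : R) : 0 <= x -> 1 <= expR x by rewrite -expR0 ler_expR.
  by rewrite /C mulr_ege1 ?exprn_ege1 ?mulr_ege1 ?exprn_ege1 ?e1.
have C0 : 0 < C by exact: lt_le_trans C1.
apply: le_trans (glim_le_len nmP rho1 rhoM _ _) _; rewrite lerD2r.
rewrite -ler_expR expR_len lnK ?posrE //; apply: gsize_le => //.
  by apply: bound => // t tm i; exact: near1.
(* The size also involves the inverse, which is bounded by running the chain backwards. *)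
rewrite invgM invgK.
have := bound m (fun t => g (m - t)%N) r1 D r10 D0; rewrite /= subnn.
rewrite [X in (_ -> _ -> mxle _ _ X)](_ : _ = rho ((g m)^-1 * g 0%N)%g); last by rewrite subn0.
apply=> [t tm|t tm i]; last exact: near2.
rewrite -lenV invgM invgK; have := stepl (m - t.+1)%N; rewrite -subSn // subSS; apply; lia.
Qed.

End Coordinates.

(** * The degree valuation *)

Section DegreeNorm.
Variables (R : realType) (A : idomainType) (deg : A -> nat).
Hypothesis degA : Noether.degree_ring deg.
Local Notation "x %:F" := (@tofrac A x).

Lemma fraction_surj (x : {fraction A}) : exists a b, b != 0 /\ x * b%:F = a%:F.
Proof.
elim/quotW: x => r; exists (frac r).1, (frac r).2; split; first exact: denom_ratioP.
unlock tofrac; rewrite -[LHS]FracField.pi_mul; apply/eqmodP => /=.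
rewrite /FracField.equivf /FracField.mulf /= !numden_Ratio ?oner_neq0 ?mulr1 ?denom_ratioP //.
by rewrite mulrC.
Qed.

(** The absolute value at infinity: large degree means large norm. *)
Definition degnorm (a : A) : R := if a == 0 then 0 else expR (deg a)%:R.

Lemma degnorm_gt0 a : a != 0 -> 0 < degnorm a.
Proof. by rewrite /degnorm => /negbTE ->; exact: expR_gt0. Qed.

Lemma degnorm_ge0 a : 0 <= degnorm a.
Proof. by rewrite /degnorm; case: ifP => // _; exact: expR_ge0. Qed.

Lemma degnormM a b : degnorm (a * b) = degnorm a * degnorm b.
Proof.
rewrite /degnorm mulf_eq0; case: eqVneq => a0 /=; first by rewrite mul0r.
case: eqVneq => b0 /=; first by rewrite mulr0.
by rewrite (Noether.deg_mul degA) // natrD expRD.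
Qed.

Lemma degnormD a b : degnorm (a + b) <= Num.max (degnorm a) (degnorm b).
Proof.
have [a0|a0] := eqVneq a 0; first by rewrite a0 add0r le_max lexx orbT.
have [b0|b0] := eqVneq b 0; first by rewrite b0 addr0 le_max lexx.
have [ab0|ab0] := eqVneq (a + b) 0.
  by rewrite ab0 {1}/degnorm eqxx le_max degnorm_ge0.
rewrite /degnorm (negbTE a0) (negbTE b0) (negbTE ab0) le_max !ler_expR !ler_nat.
by have := Noether.deg_add degA a b; rewrite leq_max.
Qed.

(** Numerators and denominators are chosen, and multiplicativity of [degnorm] makes the quotient of
    norms independent of the choice. *)
Lemma fracnorm_exists : exists nm : {fraction A} -> R,
  ultranorm nm /\ forall a, nm a%:F = degnorm a.
Proof.
have /choice[nd ndP] : forall x : {fraction A}, exists ab : A * A,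
    ab.2 != 0 /\ x * ab.2%:F = ab.1%:F.
  by move=> x; have [a [b H]] := fraction_surj x; exists (a, b).
pose nm x := degnorm (nd x).1 / degnorm (nd x).2.
have nmE x a b : b != 0 -> x * b%:F = a%:F -> nm x = degnorm a / degnorm b.
  move=> b0 xb; have [d0 xd] := ndP x.
  have E : (nd x).1 * b = a * (nd x).2.
    by apply/eqP; rewrite -tofrac_eq !tofracM -xd -xb mulrAC.
  have d1 := degnorm_gt0 d0; have b1 := degnorm_gt0 b0.
  by apply/eqP; rewrite /nm eqr_div ?(gt_eqF d1) ?(gt_eqF b1) // -!degnormM E.
have one : degnorm 1 = 1.
  have n1 : degnorm 1 != 0 by rewrite gt_eqF // degnorm_gt0 // oner_neq0.
  by apply: (mulfI n1); rewrite -degnormM !mulr1.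
have nmF a : nm a%:F = degnorm a.
  by rewrite (nmE _ a 1) ?oner_neq0 ?tofrac1 ?mulr1 // one divr1.
have z : degnorm 0 = 0 by rewrite /degnorm eqxx.
exists nm; split=> //; split.
- by move=> x; rewrite divr_ge0 ?degnorm_ge0.
- by rewrite -tofrac0 nmF.
- move=> x; have [d0 xd] := ndP x.
  move/eqP; rewrite mulf_eq0 invr_eq0 orbC gt_eqF ?degnorm_gt0 //= => a0.
  have /eqP a0' : (nd x).1 == 0.
    by apply: contraLR a0 => a0; rewrite gt_eqF ?degnorm_gt0.
  by move/eqP: xd; rewrite a0' tofrac0 mulf_eq0 tofrac_eq0 (negbTE d0) orbF => /eqP.
- move=> x y; have [d0 xd] := ndP x; have [e0 ye] := ndP y.
  rewrite (nmE (x * y) ((nd x).1 * (nd y).1) ((nd x).2 * (nd y).2)) ?mulf_neq0 //.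
    by rewrite !degnormM mulf_div.
  by rewrite !tofracM -xd -ye; ring.
- move=> x y; have [d0 xd] := ndP x; have [e0 ye] := ndP y.
  rewrite (nmE (x + y) ((nd x).1 * (nd y).2 + (nd y).1 * (nd x).2) ((nd x).2 * (nd y).2)) ?mulf_neq0 //.
    have dp := degnorm_gt0 d0; have ep := degnorm_gt0 e0.
    rewrite ler_pdivrMr ?degnorm_gt0 ?mulf_neq0 // maxr_pMl ?degnorm_ge0 //.
    apply: le_trans (degnormD _ _) _; rewrite !degnormM /nm.
    have -> : degnorm (nd x).1 / degnorm (nd x).2 * (degnorm (nd x).2 * degnorm (nd y).2) =
      degnorm (nd x).1 * degnorm (nd y).2 by field; rewrite gt_eqF.
    have -> : degnorm (nd y).1 / degnorm (nd y).2 * (degnorm (nd x).2 * degnorm (nd y).2) =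
      degnorm (nd y).1 * degnorm (nd x).2 by field; rewrite gt_eqF.
    exact: lexx.
  by rewrite tofracD !tofracM -xd -ye; ring.
Qed.

Lemma degnorm_finite (M : nat) (C : R) :
  finite_set [set X : 'M[A]_M | forall i j, degnorm (X i j) <= C].
Proof.
have [s sP] := Noether.deg_finite degA (Num.bound C).
(* Zero is listed separately, since its norm says nothing about [deg 0]; elsewhere
   [deg a <= expR (deg a) <= C]. *)
pose mk (h : 'M['I_(size (0 :: s))]_M) : 'M[A]_M := \matrix_(i, j) (0 :: s)`_(h i j).
apply: (@sub_finite_set _ _ (range mk)); last exact/finite_image/finite_finset.
move=> X /= XC.
have XS i j : X i j \in 0 :: s.
  have [->|x0] := eqVneq (X i j) 0; first exact: mem_head.
  rewrite in_cons sP ?orbT // -(ler_nat R); apply: ltW.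
  have := XC i j; rewrite /degnorm (negbTE x0) => le.
  have C0 : 0 <= C by apply: le_trans le; exact: expR_ge0.
  apply: le_lt_trans (archi_boundP C0); apply: le_trans le.
  by apply: le_trans (expR_ge1Dx _); rewrite lerDr.
exists (\matrix_(i, j) Ordinal (etrans (index_mem (X i j) (0 :: s)) (XS i j))) => //.
by apply/matrixP => i j; rewrite !mxE nth_index.
Qed.

End DegreeNorm.

(** * From generators to representations over fields *)

Section Generation.
Variables (G : groupType) (P : G -> Prop).
Hypotheses (P1 : P 1%g) (PM : forall x y, P x -> P y -> P (x * y)%g).
Hypothesis PV : forall x, P x -> P x^-1%g.

(** The boolean form lets [P] define a [groupClosed] predicate, to which finite generation
    applies. *)
Definition asbool_pred : {pred G} := fun x => `[<P x>].

Fact asbool_mul_closed : mulg_closed asbool_pred.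
Proof. by move=> x y /asboolP Px /asboolP Py; apply/asboolP; exact: PM. Qed.
Fact asbool_one_closed : 1%g \in asbool_pred. Proof. exact/asboolP. Qed.
Fact asbool_inv_closed : invg_closed asbool_pred.
Proof. by move=> x /asboolP Px; apply/asboolP; exact: PV. Qed.

HB.instance Definition _ := isMulClosed.Build G asbool_pred asbool_mul_closed.
HB.instance Definition _ := isMul1Closed.Build G asbool_pred asbool_one_closed.
HB.instance Definition _ := isInvClosed.Build G asbool_pred asbool_inv_closed.

Lemma generated_ind (S : seq G) :
    (forall H : groupClosed G, {subset S <= H} -> forall x, x \in H) ->
  (forall x, x \in S -> P x) -> forall x, P x.
Proof.
move=> gen SP x; apply/asboolP.
by apply: (gen (asbool_pred : groupClosed G)) => y yS; apply/asboolP; exact: SP.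
Qed.

End Generation.

Section ScaledMorphism.
Variables (A : idomainType) (K L : fieldType) (n M : nat) (f : A).
Variables (D : 'M[K]_n -> Prop) (alpha : 'M[K]_n -> 'M[A]_M) (phi : {rmorphism A -> L}).
Hypothesis rep : scaled_rep f D alpha.
Hypothesis phif : phi f != 0.

(** Dividing by the scale gives a genuine representation, over the fraction field of [A] as well as
    over the residue field of a specialization. *)
Definition unscale (X : 'M[K]_n) : 'M[L]_M := (phi f)^-1 *: map_mx phi (alpha X).

Lemma unscale1 : unscale 1%:M = 1%:M.
Proof. by rewrite /unscale (srep_1 rep) map_scalar_mx scale_scalar_mx mulVf. Qed.

Lemma unscaleM X Y : D X -> D Y -> unscale (X *m Y) = unscale X *m unscale Y.
Proof.
move=> DX DY; rewrite /unscale -scalemxAl -scalemxAr -map_mxM -(srep_M rep) //.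
by rewrite map_mxZ scalerK.
Qed.

End ScaledMorphism.

Section SubgroupMatrix.
Variables (K : fieldType) (n : nat) (G : groupClosed (GL K n)).

Definition subgroup_mx (g : subgroup_type G) : 'M[K]_n := val (val g).

Lemma subgroup_mxM g h : subgroup_mx (g * h)%g = subgroup_mx g *m subgroup_mx h.
Proof. by []. Qed.

Lemma subgroup_mxX g i : subgroup_mx (g ^+ i)%g = subgroup_mx g ^+ i.
Proof.
by elim: i => [|i IH]; rewrite ?expg0 // expgS subgroup_mxM IH exprS.
Qed.

Lemma subgroup_mx_inj : injective subgroup_mx.
Proof. by move=> g h /val_inj/val_inj. Qed.

End SubgroupMatrix.

Theorem theorem3p3 (R : realType) (K : fieldType) (p : nat)
    (hp : p \in [pchar K]) (n : nat) (G : groupClosed (GL K n))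
    (hG : finitely_generated (subgroup_type G)) :
  exists d : left_invariant_metric R (subgroup_type G),
    proper_metric d /\
    uniformly_finite_asdim
      (fun F : finite_subgroup (subgroup_type G) => quotient_space d F).
Proof.
have [S gen] := hG.
pose mx := @subgroup_mx K n G.
(* [D] is closed under products but not under inverses, so the inverses of the generators are listed
   too. *)
have [A [deg [M [f [D [alpha [degA pA rep DS]]]]]]] :=
  exists_scaled_rep ([seq mx s | s <- S] ++ [seq mx s^-1%g | s <- S]) hp.
have DG g : D (mx g).
  suff [] : D (mx g) /\ D (mx g^-1%g) by [].
  apply: (generated_ind (P := fun g => D (mx g) /\ D (mx g^-1%g)) _ _ _ gen).
  - by rewrite invg1; split; exact: srep_D1 rep.
  - move=> x y [Dx Dx'] [Dy Dy']; rewrite invgM.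
    by split; exact: (srep_DM rep).
  - by move=> x [Dx Dx']; rewrite invgK.
  - by move=> s sS; split; apply: DS; rewrite mem_cat; apply/orP;
      [left|right]; apply/mapP; exists s.
have [nm [nmP nmF]] := fracnorm_exists R degA.
have [k [s sf]] := Noether.deg_specialize degA (srep_f rep).
have tf : @tofrac A f != 0 by rewrite tofrac_eq0 (srep_f rep).
have pL : p \in [pchar {fraction A}] by exact: (rmorph_pchar (@tofrac A) pA).
(* [rho] carries the metric; [pi] is the reduction with finitely many values. *)
pose rho g := unscale f alpha (@tofrac A) (mx g).
pose pi g := unscale f alpha s (mx g).
have rho1 : rho 1%g = 1%:M by exact: unscale1 rep tf.
have pi1 : pi 1%g = 1%:M by exact: unscale1 rep sf.
have rhoM g h : rho (g * h)%g = rho g *m rho h by exact (unscaleM rep tf (DG g) (DG h)).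
have piM g h : pi (g * h)%g = pi g *m pi h by exact (unscaleM rep sf (DG g) (DG h)).
have pi_ker x b : pi x = pi 1%g -> ~~ (p %| b)%N -> (x ^+ b)%g = 1%g -> x = 1%g.
  move=> x1 pb xb; apply: (@subgroup_mx_inj _ _ G).
  apply: (specialization_kernel rep pA sf (DG x) _ _ pb).
    transitivity (s f *: pi x); last by rewrite x1 pi1 scale_scalar_mx mulr1.
    by rewrite /pi /unscale scalerA divff // scale1r.
  by rewrite -subgroup_mxX xb.
have pi_inj g (a b : 'M[k]_M) : a *m pi g = b *m pi g -> a = b.
  have piV : pi g *m pi g^-1%g = 1%:M by rewrite -piM mulgV.
  by move=> /(congr1 (mulmx^~ (pi g^-1%g))); rewrite -!mulmxA piV !mulmx1.
(* A bound on [rho g] bounds the degrees in [alpha (mx g)] after clearing the denominator [f];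
   finitely many matrices remain, and [alpha] is injective on [D]. *)
have rho_fin (C : R) : finite_set [set g | mxle nm C (rho g)].
  apply: (@sub_finite_set _ _ ((alpha \o mx) @^-1`
      [set X : 'M[A]_M | forall i j, degnorm R deg (X i j) <= C * degnorm R deg f])).
    move=> g /= gC i j; have := gC i j.
    rewrite /rho /unscale !mxE (nmM nmP) (nmV nmP) !nmF mulrC ler_pdivrMr //.
    by rewrite degnorm_gt0 // (srep_f rep).
  apply: finite_preimage; last exact: degnorm_finite.
  move=> g h _ _ /= /(srep_inj rep (DG g) (DG h)); exact: subgroup_mx_inj.
exists (glim nmP rho1 rhoM); split; first exact: glim_proper.
exact (linear_asdim (Gam := 'M[k]_M) nmP pL rho1 rhoM piM pi_ker pi_inj).
Qed.
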